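(* There exist universal constants $0 < \delta^* < 1$ and $C > 0$ such that the following holds. Let $\Phi = \{\phi_\iota : \iota\in\mathcal{I}\} \subset L^2_\rho(D)$ be a finite dictionary consisting of $n$ linearly independent functions, with constants $0 < a \leq b < \infty$ such that $$a \|c\|_{\ell^2(\mathcal{I})}^2 \leq \Big\| \sum_{\iota \in \mathcal{I}} c_\iota \phi_\iota \Big\|_{L^2_\rho(D)}^2 \leq b \|c\|_{\ell^2(\mathcal{I})}^2, \quad \forall c = (c_\iota)_{\iota\in\mathcal{I}} \in \mathbb{C}^n.$$ Let $\mu$ be a probability measure on $D$ that is absolutely continuous with respect to $\rho$ with Radon--Nikodym derivative strictly positive almost everywhere on $\mathrm{supp}(\mu)$, let $1 \leq t \leq n$, $0 < \delta < \delta^*$, $0 < \epsilon < 1$, and let $y_1,\ldots,y_m$ be independent with $y_i \sim \mu$ for $i=1,\ldots,m$. Define $$\Gamma = \Gamma(\Phi,w) = \left\| \max_{\iota\in\mathcal{I}} \left\{ \sqrt{w(\cdot)}\, |\phi_\iota(\cdot)| \right\} \right\|_{L^\infty_\rho(D)},$$ where $w$ is the weight function defined by $d\mu(y) = \frac{1}{w(y)}\, d\rho(y)$, and suppose that $$m \geq C \cdot \delta^{-2} \cdot (\Gamma^2/a) \cdot t \cdot \left( \log(\mathrm{e} n) \cdot \log^2\left(\mathrm{e} (\Gamma^2/a) t/\delta\right) + \log(2/\epsilon) \right).$$ Then, with probability at least $1-\epsilon$, the norm equivalence $$\alpha \|p\|_{L^2_\rho(D)}^2 \leq \frac1m \sum_{i=1}^m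 w(y_i)|p(y_i)|^2 \leq \beta \|p\|_{L^2_\rho(D)}^2, \quad \forall p \in P_T,\ T \subseteq \mathcal{I},\ |T| \leq t,$$ holds with constants satisfying $1-\delta \leq \alpha \leq \beta \leq 1+\delta$.
   Context: $(D,\mathcal{D},\rho)$ is a probability space (with $D$ typically a subset of $\mathbb{R}^d$), and $L^2_\rho(D)$, $L^\infty_\rho(D)$ are the usual Lebesgue spaces of complex-valued functions. For $T \subseteq \mathcal{I}$, $P_T = \{ \sum_{\iota\in T} c_\iota \phi_\iota : c_\iota \in \mathbb{C} \}$. The weight $w$ is the reciprocal of the Radon--Nikodym derivative $d\mu/d\rho$; it is finite almost everywhere on $\mathrm{supp}(\mu)$ (where $d\mu/d\rho = 0$, $w = +\infty$, with the convention $0\cdot\infty=0$). $\mathrm{e}$ is Euler's number. *)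

(* Defs.v *)
From HB Require Import structures.
From mathcomp Require Import all_boot all_order all_algebra.
From mathcomp Require Export complex.
From mathcomp Require Import all_classical all_reals all_analysis.

Set Implicit Arguments.
Unset Strict Implicit.
Unset Printing Implicit Defensive.

Import Order.TTheory GRing.Theory Num.Theory.
Import numFieldNormedType.Exports.

Local Open Scope classical_set_scope.
Local Open Scope ring_scope.
Local Open Scope charge_scope.
Local Open Scope ereal_scope.

(* The modulus of a complex number, as an element of R (the norm `|z| is
   R[i]-valued). *)
Notation normc := ComplexField.Normc.normc.

(* No compatibility between the topology and the sigma-algebra is built in: the
   topology is only used to give a meaning to the support of a measure.  With
   the Borel sigma-algebra one gets the usual setting. *)
#[short(type="topMeasurableType")]
HB.structure Definition TopMeasurable d := {T of Topological T & Measurable d T}.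

(* The usual topological support when open sets are measurable; otherwise only
   the measurable neighbourhoods are tested. *)
Definition msupport d (D : topMeasurableType d) (R : realType)
    (mu : {measure set D -> \bar R}) : set D :=
  [set x | forall U : set D, nbhs x U -> measurable U -> 0 < mu U].

Section spaces.
Context d (D : measurableType d) (R : realType).
Variable rho : probability D R.

Definition L2norm (f : D -> R[i]) : \bar R :=
  'N[rho]_(2%:E)[(fun x => (normc (f x))%:E)].

Definition L2fun (f : D -> R[i]) : Prop :=
  [/\ measurable_fun [set: D] (fun x => complex.Re (f x)),
      measurable_fun [set: D] (fun x => complex.Im (f x)) &
      L2norm f < +oo].

Variables (I : finType) (phi : I -> D -> R[i]).

Definition lincomb (c : I -> R[i]) (x : D) : R[i] :=
  (\sum_(i : I) c i * phi i x)%R.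

(* Linear independence in L^2, where functions are identified when they agree
   rho-almost everywhere. *)
Definition lin_indep : Prop :=
  forall c : I -> R[i],
    {ae rho, forall x, lincomb c x = 0%R} -> forall i, c i = 0%R.

Definition polspan (T : {set I}) : set (D -> R[i]) :=
  [set p | exists c : I -> R[i],
      p = (fun x => \sum_(i in T) c i * phi i x)%R].

Definition RNderiv (mu : probability D R) : D -> \bar R :=
  'd (charge_of_finite_measure mu) '/d rho.

(* Inversion in \bar R satisfies 0^-1 = +oo, and multiplication satisfies
   0 * +oo = 0. *)
Definition weight (mu : probability D R) (y : D) : \bar R :=
  (RNderiv mu y)^-1.

Definition Gamma_of (w : D -> \bar R) : \bar R :=
  'N[rho]_(+oo)[(fun y =>
     \big[maxe/0]_(i : I) (sqrte (w y) * (normc (phi i y))%:E))].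

End spaces.

Definition mutually_independent d d' (Omega : measurableType d)
    (D : measurableType d') (R : realType) (P : probability Omega R) (m : nat)
    (y : 'I_m -> Omega -> D) : Prop :=
  forall (J : {set 'I_m}) (B : 'I_m -> set D),
    (forall j, measurable (B j)) ->
    P (\bigcap_(j in [set` J]) (y j @^-1` B j)) =
    \prod_(j in J) P (y j @^-1` B j).

(* Main.v *)
Require Import Defs.
From HB Require Import structures.
From mathcomp Require Import all_boot all_order all_algebra complex.
From mathcomp Require Import all_classical all_reals all_analysis.
From mathcomp Require Import measurable_realfun ess_sup_inf ring lra.

(* If p lies in P_T and ||p|| = 1, then the real and imaginary parts of
   sqrt w p lie in the absolutely convex hull of 2 n real functions bounded by
   M = 2 Gamma sqrt (t / a), so only the l1 norm of the coefficients matters.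
   Rounding the real and imaginary parts of sqrt w phi_i to a fine grid turns
   the sample into independent points of a finite probability space.

   There, a ghost sample and random swaps reduce the deviation of empirical
   second moments to the Rademacher process f |-> sum_l +-f(l)^2 on the convex
   hull.  This process is chained along the scales r_j = M / 2^j: f is replaced
   at scale j by an average g_j of s_j = 4^j U dictionary elements (Maurey), and
   f^2 by its excess (f^2 - r_j^2)_+ over the scale, with U of order ln (e M^2).
   Below the scale the excess vanishes unless |f - g_j| > r_j / 2, which the
   exponential moments of g_j make negligible; above it only the second moment of
   f - g_j, of order r_j^2 / U, enters, which cancels the factor U of the entropy
   s_j ln N.  The remaining increments (f^2 - r_{j+1}^2)_+ - (f^2 - r_j^2)_+
   telescope in j, so the factor U is paid once rather than at every scale, and
   the total cost is ln N times J (J + U), a square of a logarithm. *)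

Set Implicit Arguments.
Unset Strict Implicit.
Unset Printing Implicit Defensive.

Import Order.TTheory GRing.Theory Num.Theory.
Import numFieldNormedType.Exports.

Local Open Scope classical_set_scope.
Local Open Scope ring_scope.

(** Sparsity enters only through the bound sqrt (t / a) on the l1 norm of a normalised coefficient
    vector, so no union over the supports [T] is taken and the size of the dictionary costs a single
    ln n. The event to be controlled quantifies over uncountably many coefficient vectors; after
    rounding it depends only on the cell of each sample point, which makes it a finite union of
    measurable sets and turns expectations into finite sums. Errors are measured relatively, against
    #|L| plus the empirical second moment: the energy produced by the sign bound is itself random,
    and a relative error lets it be absorbed at the end. For this reason a sign sum is bounded by a
    quadratic term plus T / lam with lam fixed beforehand, and not by the square root that an
    optimal lam would give. Each scale uses the sum of two such rates: one matched to the entropy,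
    with the same cost at all scales, and one matched to ln (2 / eps), whose cost decays
    geometrically, so that the confidence term carries no logarithmic factor. *)

(** * Exponential inequalities and Rademacher sums *)

(** Averaging over a centred variable removes the linear term and leaves a sub-Gaussian factor. For
    x <= 1/2 the bound follows from expR x <= 1 / (1 - x); beyond 1/2 already x <= 2 x^2. *)
Lemma expR_le_add (R : realType) (x : R) : expR x <= x + expR (2 * x ^+ 2).
Proof.
have [xh|xh] := leP x (1/2).
  apply: (@le_trans _ _ (1 + x + 2 * x ^+ 2)); last first.
    by have := expR_ge1Dx (2 * x ^+ 2); lra.
  have h : 0 < 1 - x by lra.
  have := expR_ge1Dx (- x); rewrite expRN => hx.
  have ex0 := expR_gt0 x.
  have : (1 - x) * expR x <= 1.
    by move: hx; rewrite -[X in _ <= X]mul1r ler_pdivlMr.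
  move=> h1.
  have h2 : 1 <= (1 - x) * (1 + x + 2 * x ^+ 2).
    have : 0 <= x ^+ 2 * (1 - 2 * x) by rewrite mulr_ge0 ?sqr_ge0 //; lra.
    nra.
  by rewrite -(ler_pM2l h) (le_trans h1).
have : expR x <= expR (2 * x ^+ 2) by rewrite ler_expR; nra.
lra.
Qed.

Lemma expR_ge_sqr (R : realType) (x : R) : 0 <= x -> x ^+ 2 <= 4 * expR x.
Proof.
move=> x0; have := expR_ge1Dx (x / 2).
have -> : expR x = expR (x / 2) ^+ 2 by rewrite -expRM_natl; congr expR; field.
by have := expR_gt0 (x/2); nra.
Qed.

Lemma expR_ge_pow4 (R : realType) (x : R) : 0 <= x -> x ^+ 4 <= 256 * expR x.
Proof.
move=> x0; have h := expR_ge1Dx (x / 4).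
have -> : expR x = expR (x / 4) ^+ 4 by rewrite -expRM_natl; congr expR; field.
have -> : 256 = 4 ^+ 4 :> R by ring.
rewrite -exprMn ler_pXn2r ?nnegrE ?mulr_ge0 ?expR_ge0 //.
lra.
Qed.

Section Rademacher.
Context {R : realType} {L : finType}.
Implicit Types (a : L -> R) (e : {ffun L -> bool}).

Lemma rademacher_mgf a :
  \sum_(e : {ffun L -> bool}) expR (\sum_l (-1) ^+ e l * a l)
  <= 2 ^+ #|L| * expR (2 * \sum_l a l ^+ 2).
Proof.
under eq_bigr do rewrite expR_sum.
rewrite -(bigA_distr_bigA (fun l b => expR ((-1) ^+ (b : bool) * a l))).
rewrite mulr_sumr expR_sum.
rewrite -[X in _ <= X * _]prodr_const -big_split /=.
apply: ler_prod => l _; rewrite big_bool /= expr0 expr1 mul1r mulN1r.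
rewrite addr_ge0 ?expR_ge0 //=.
by have := expR_le_add (a l); have := expR_le_add (- a l); rewrite sqrrN; lra.
Qed.

(* The parameter lam is chosen before the vector a, which keeps the bound
   quadratic in a. *)
Lemma rademacher_tail a (lam T : R) : 0 < lam ->
  \sum_(e : {ffun L -> bool} |
      2 * lam * (\sum_l a l ^+ 2) + T / lam < `|\sum_l (-1) ^+ e l * a l|) 1
  <= 2 * expR (- T) * 2 ^+ #|L|.
Proof.
move=> lam0.
set S := \sum_l a l ^+ 2.
have mgf (c : R) : \sum_(e : {ffun L -> bool})
    expR (c * \sum_l (-1) ^+ e l * a l) <= 2 ^+ #|L| * expR (2 * (c ^+ 2 * S)).
  have := rademacher_mgf (fun l => c * a l).
  under [in X in _ <= X -> _]eq_bigr do rewrite exprMn.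
  rewrite -mulr_sumr; apply: le_trans; rewrite le_eqVlt; apply/orP; left.
  apply/eqP/eq_bigr => e _; congr expR; rewrite mulr_sumr.
  by apply: eq_bigr => l _; rewrite mulrCA.
have {}mgf : \sum_(e : {ffun L -> bool})
    (expR (lam * \sum_l (-1) ^+ e l * a l) + expR (- lam * \sum_l (-1) ^+ e l * a l))
    <= 2 * (2 ^+ #|L| * expR (2 * (lam ^+ 2 * S))).
  rewrite big_split /=; have := mgf lam; have := mgf (- lam); rewrite sqrrN; lra.
set K := 2 * (lam ^+ 2 * S).
have -> : 2 * expR (- T) * 2 ^+ #|L| =
    (2 * (2 ^+ #|L| * expR K)) * expR (- (K + T)).
  by rewrite opprD expRD (expRN K); have := lt0r_neq0 (expR_gt0 K) => ?; field.
rewrite -ler_pdivrMr ?expR_gt0 // -expRN opprK; apply: le_trans mgf.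
rewrite mulr_suml.
apply: le_trans (_ : _ <= \sum_(e : {ffun L -> bool} |
      2 * lam * S + T / lam < `|\sum_l (-1) ^+ e l * a l|)
   (expR (lam * \sum_l (-1) ^+ e l * a l) + expR (- lam * \sum_l (-1) ^+ e l * a l))) _.
  apply: ler_sum => e; set z := \sum_l _ => ez; rewrite mul1r.
  have h : K + T <= lam * `|z|.
    have : lam * (2 * lam * S + T / lam) <= lam * `|z| by rewrite ler_pM2l // ltW.
    by apply: le_trans; rewrite le_eqVlt; apply/orP; left; apply/eqP; rewrite /K; field; rewrite gt_eqF.
  apply: (@le_trans _ _ (expR (lam * `|z|))); first by rewrite ler_expR.
  have := expR_ge0 (lam * z); have := expR_ge0 (- (lam * z)).
  by have [?|?] := ger0P z; rewrite ?mulrN ?mulNr; lra.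
rewrite [X in _ <= X](bigID (fun e => 2 * lam * S + T / lam < `|\sum_l (-1) ^+ e l * a l|)) /=.
by rewrite lerDl sumr_ge0 // => e _; rewrite addr_ge0 ?expR_ge0.
Qed.

End Rademacher.

Lemma expR_half_le2 (R : realType) : expR (1/2) <= 2 :> R.
Proof.
have h : 1/2 <= expR (- (1/2)) :> R by apply: le_trans (expR_ge1Dx _); lra.
rewrite -[leLHS]invrK -expRN -[leRHS]invrK lef_pV2 ?posrE ?invr_gt0 ?expR_gt0 //.
by move: h; lra.
Qed.

Lemma expR1_le4 (R : realType) : expR 1 <= 4 :> R.
Proof.
have -> : expR 1 = expR (1/2) ^+ 2 :> R by rewrite -expRM_natl; congr expR; field.
by have := expR_half_le2 R; have := expR_gt0 (1/2 : R); nra.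
Qed.

(** * Squares thresholded at a scale *)

Section Threshold.
Context {R : realType}.

Definition excess (r x : R) : R := Num.max (x ^+ 2 - r ^+ 2) 0.

Lemma excess_ge0 r x : 0 <= excess r x.
Proof. by rewrite /excess le_max lexx orbT. Qed.

Lemma excess_le r x : excess r x <= x ^+ 2.
Proof. by rewrite /excess ge_max sqr_ge0 andbT lerBlDr lerDl sqr_ge0. Qed.

Lemma excess0 r x : `|x| <= r -> excess r x = 0.
Proof.
move=> xr; apply/max_idPr; rewrite subr_le0 -real_normK ?num_real //.
by rewrite ler_pXn2r ?nnegrE // (le_trans _ xr).
Qed.

(** A dichotomy on e = |x - y|. If e <= 2 |x|, the squares differ by at most 4 e |x|, which gives
    the first term. If e > 2 |x| and e <= r / 2, both |x| and |y| are at most r and both excesses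
    vanish: this is the gain of the threshold. Only e > r / 2 leaves the quartic term. *)
Lemma excess_dist (r x y : R) : 0 < r ->
  (excess r x - excess r y) ^+ 2 <=
  16 * `|x - y| ^+ 2 * x ^+ 2 + 4 * `|x - y| ^+ 4 * (r / 2 < `|x - y|)%R%:R.
Proof.
move=> r0; set e := `|x - y|.
have e0 : 0 <= e by exact: normr_ge0.
have lip : `|excess r x - excess r y| <= `|x ^+ 2 - y ^+ 2|.
  rewrite /excess !maxEle; case: ifP => h1; case: ifP => h2.
  - by rewrite subrr normr0.
  - rewrite sub0r normrN ger0_norm; last by move/negbT: h2; rewrite -ltNge => /ltW.
    by rewrite distrC ger0_norm; move/negbT: h2; rewrite -ltNge => h2; lra.
  - move/negbT: h1; rewrite -ltNge => h1.
    by rewrite subr0 !ger0_norm; lra.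
  - by rewrite opprB addrA subrK.
have xy : `|x ^+ 2 - y ^+ 2| <= e * (2 * `|x| + e).
  rewrite subr_sqr normrM ler_wpM2l //.
  have -> : x + y = 2 * x - (x - y) by ring.
  by apply: le_trans (ler_normB _ _) _; rewrite normrM ger0_norm.
have x0 : 0 <= `|x| by exact: normr_ge0.
have [h|h] := leP e (2 * `|x|).
  have : `|excess r x - excess r y| <= 4 * e * `|x|.
    by apply: le_trans lip (le_trans xy _); nra.
  move=> h1; apply: (@le_trans _ _ (16 * e ^+ 2 * x ^+ 2)).
    rewrite -[x ^+ 2]real_normK ?num_real // -real_normK ?num_real //.
    have -> : 16 * e ^+ 2 * `|x| ^+ 2 = (4 * e * `|x|) ^+ 2 by ring.
    by rewrite ler_pXn2r ?nnegrE // !mulr_ge0.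
  by rewrite lerDl !mulr_ge0 ?exprn_ge0 ?ler0n.
apply: ler_wpDl; first by rewrite mulr_ge0 ?sqr_ge0 // mulr_ge0 ?sqr_ge0.
have [h2|h2] := ltP (r / 2) e; last first.
  have yx : `|y| <= `|x| + e.
    have -> : y = x - (x - y) by ring.
    exact: ler_normB.
  by rewrite !excess0 ?subr0 ?expr0n ?mulr0 //; lra.
rewrite mulr1 -real_normK ?num_real //.
have -> : 4 * e ^+ 4 = (2 * e ^+ 2) ^+ 2 by ring.
rewrite ler_pXn2r ?nnegrE ?mulr_ge0 //.
by apply: le_trans lip (le_trans xy _); nra.
Qed.

End Threshold.

(** * Maurey's empirical method *)

Section Maurey.
Context {R : realType} {I L : finType} (v : I -> L -> R) (M : R).
Hypothesis vM : forall i l, `|v i l| <= M.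

Definition simplex (lam : I -> R) := (forall i, 0 <= lam i) /\ \sum_i lam i = 1.

Definition mix (lam : I -> R) (l : L) : R := \sum_i lam i * v i l.

Definition avg s (t : {ffun 'I_s -> I}) (l : L) : R :=
  s%:R^-1 * \sum_k v (t k) l.

Lemma norm_mix lam l : simplex lam -> `|mix lam l| <= M.
Proof.
move=> [l0 l1]; apply: le_trans (ler_norm_sum _ _ _) _.
rewrite -[M]mul1r -l1 mulr_suml; apply: ler_sum => i _.
by rewrite normrM (ger0_norm (l0 i)) ler_wpM2l.
Qed.

Lemma norm_avg s (t : {ffun 'I_s -> I}) l : 0 <= M -> `|avg t l| <= M.
Proof.
move=> M0; rewrite /avg normrM normfV normr_nat.
case: s t => [|s] t; first by rewrite invr0 mul0r.
rewrite mulrC ler_pdivrMr ?ltr0n //; apply: le_trans (ler_norm_sum _ _ _) _.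
apply: le_trans (ler_sum _ (fun k _ => vM (t k) l)) _.
by rewrite sumr_const card_ord -[X in X <= _]mulr_natr.
Qed.

(** The products of [lam] along a tuple are the law of [s] independent draws from [lam];
    expectations over the draws are sums with these weights. *)
Lemma sum_weights (lam : I -> R) s : simplex lam ->
  \sum_(t : {ffun 'I_s -> I}) \prod_k lam (t k) = 1.
Proof.
move=> [_ l1]; rewrite -(bigA_distr_bigA (fun _ i => lam i)) /=.
by rewrite big1 // => k _.
Qed.

Lemma weights_ge0 (lam : I -> R) s (t : {ffun 'I_s -> I}) : simplex lam ->
  0 <= \prod_k lam (t k).
Proof. by move=> [l0 _]; apply: prodr_ge0. Qed.

(** First-moment method: were every value above [B], the nonnegative weighted gaps would sum to
    zero, so all weights would vanish, against their total 1. *)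
Lemma mean_le_exists (lam : I -> R) s (F : {ffun 'I_s -> I} -> R) B : simplex lam ->
  \sum_(t : {ffun 'I_s -> I}) (\prod_k lam (t k)) * F t <= B -> exists t, F t <= B.
Proof.
move=> lamP FB; apply: contrapT => /forallNP h.
have {}h t : B < F t by rewrite ltNge; apply/negP.
have w0 (t : {ffun 'I_s -> I}) : 0 <= \prod_k lam (t k) * (F t - B).
  by rewrite mulr_ge0 ?weights_ge0 // subr_ge0 ltW.
have : \sum_(t : {ffun 'I_s -> I}) (\prod_k lam (t k)) * (F t - B) <= 0.
  under eq_bigr do rewrite mulrBr.
  by rewrite sumrB -mulr_suml sum_weights // mul1r subr_le0.
move=> s0; have /eqP : \sum_(t : {ffun 'I_s -> I}) (\prod_k lam (t k)) * (F t - B) = 0.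
  by apply/eqP; rewrite eq_le s0 sumr_ge0.
rewrite psumr_eq0 // => /allP w00.
have := sum_weights s lamP; rewrite big1 => [/eqP|t _]; first by rewrite eq_sym oner_eq0.
have := w00 t (mem_index_enum _); rewrite /= mulf_eq0 subr_eq0 (gt_eqF (h t)) orbF.
by move=> /eqP.
Qed.

Lemma centered_mgf lam (th : R) l : simplex lam ->
  \sum_i lam i * expR (th * (v i l - mix lam l)) <= expR (8 * th ^+ 2 * M ^+ 2).
Proof.
move=> lamP; have [l0 l1] := lamP.
apply: le_trans (_ : _ <= \sum_i lam i * (th * (v i l - mix lam l) + expR (8 * th ^+ 2 * M ^+ 2))) _.
  apply: ler_sum => i _; apply: ler_wpM2l => //.
  apply: le_trans (expR_le_add _) _; rewrite lerD2l ler_expR.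
  (* The centred value is at most 2 M, and 2 (2 M th)^2 is the constant 8 th^2 M^2. *)
  have : `|v i l - mix lam l| <= 2 * M.
    by apply: le_trans (ler_normB _ _) _; have := vM i l; have := norm_mix l lamP; lra.
  rewrite ler_norml; set z := _ - _ => /andP[h1 h2].
  have h3 : 0 <= (2 * M - z) * (2 * M + z) by rewrite mulr_ge0 //; lra.
  rewrite exprMn mulrA (_ : 8 * th ^+ 2 * M ^+ 2 = (2 * th ^+ 2) * (4 * M ^+ 2)); last by ring.
  by apply: ler_wpM2l; [have := sqr_ge0 th; lra | lra].
under eq_bigr do rewrite mulrDr mulrCA mulrBr.
rewrite big_split /= -mulr_sumr -mulr_suml l1 mul1r sumrB -mulr_suml l1 mul1r.
by rewrite /mix subrr mulr0 add0r.
Qed.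

Lemma avg_mgf lam s (tau : R) l : simplex lam -> (0 < s)%N ->
  \sum_(t : {ffun 'I_s -> I}) (\prod_k lam (t k)) *
     expR (tau * (avg t l - mix lam l)) <= expR (8 * tau ^+ 2 * M ^+ 2 / s%:R).
Proof.
move=> lamP s0; have s1 : s%:R != 0 :> R by rewrite pnatr_eq0 -lt0n.
under eq_bigr => t _.
  have -> : tau * (avg t l - mix lam l) =
      \sum_k (tau / s%:R) * (v (t k) l - mix lam l).
    rewrite -mulr_sumr sumrB sumr_const card_ord -mulr_natr /avg.
    by field.
  rewrite expR_sum -big_split /=; over.
rewrite -(bigA_distr_bigA (fun _ i => lam i * expR (tau / s%:R * (v i l - mix lam l)))) /=.
rewrite prodr_const card_ord.
apply: le_trans (_ : _ <= expR (8 * (tau / s%:R) ^+ 2 * M ^+ 2) ^+ s) _.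
  rewrite lerXn2r ?nnegrE ?expR_ge0 ?centered_mgf //.
  by apply: sumr_ge0 => i _; rewrite mulr_ge0 ?expR_ge0 //; case: lamP.
rewrite -expRM_natl le_eqVlt; apply/orP; left; apply/eqP; congr expR.
by field.
Qed.

Lemma avg_abs_mgf lam s (tau : R) l : simplex lam -> (0 < s)%N -> 0 <= tau ->
  \sum_(t : {ffun 'I_s -> I}) (\prod_k lam (t k)) *
     expR (tau * `|mix lam l - avg t l|) <= 2 * expR (8 * tau ^+ 2 * M ^+ 2 / s%:R).
Proof.
move=> lamP s0 tau0.
have := avg_mgf tau l lamP s0; have := avg_mgf (- tau) l lamP s0; rewrite sqrrN => h1 h2.
rewrite mulr_natl mulr2n; apply: le_trans (lerD h2 h1); rewrite -big_split /=.
apply: ler_sum => t _; rewrite -mulrDr ler_wpM2l ?weights_ge0 //.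
have := expR_ge0 (tau * (avg t l - mix lam l)).
have := expR_ge0 (- tau * (avg t l - mix lam l)).
rewrite distrC; have [?|?] := ger0P (avg t l - mix lam l); rewrite ?mulrN ?mulNr; lra.
Qed.

(** The condition on [s] says M^2 / s = r^2 / U: the average has variance of order r^2 / U, a factor
    U below the squared scale. The expected error is bounded for each l separately; the part with
    [mix lam l ^+ 2] pays for the first term of [excess_dist], the constant part for the large
    jumps, and 2^21 is what the jumps need. *)
Lemma maurey lam (r : R) (s U : nat) : simplex lam -> 0 < r -> r <= M ->
  (64 <= U)%N -> M ^+ 2 <= expR (U%:R / 256) -> s%:R * r ^+ 2 = M ^+ 2 * U%:R ->
  exists t : {ffun 'I_s -> I},
    \sum_l (excess r (mix lam l) - excess r (avg t l)) ^+ 2 <=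
    2 ^+ 21 * r ^+ 2 / U%:R * (#|L|%:R + \sum_l mix lam l ^+ 2).
Proof.
move=> lamP r0 rM U64 MU sU.
have M0 : 0 < M by apply: lt_le_trans rM.
have U0 : 64 <= U%:R :> R by rewrite ler_nat.
have s0 : (0 < s)%N.
  rewrite lt0n; apply/eqP => s0; move: sU; rewrite s0 mul0r => /eqP.
  by rewrite eq_sym gt_eqF // mulr_gt0 ?exprn_gt0 //; lra.
have Msr : M ^+ 2 / s%:R = r ^+ 2 / U%:R.
  have sn0 : s%:R != 0 :> R by rewrite pnatr_eq0 -lt0n.
  by apply: (mulIf sn0); rewrite divfK // mulrAC [r ^+ 2 * _]mulrC sU mulfK //; lra.
apply: (mean_le_exists lamP).
under eq_bigr do rewrite mulr_sumr.
rewrite exchange_big /= mulrDr -sumr_const !mulr_sumr -big_split /=.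
apply: ler_sum => l _; rewrite mulr1.
set f := mix lam l.
have Un0 : U%:R != 0 :> R by rewrite gt_eqF //; lra.
have rn0 : r != 0 by rewrite gt_eqF.
(* At this rate the exponent 8 tau1^2 M^2 / s equals 1, so [expR_ge_sqr] bounds the second moment of
   the error by a multiple of r^2 / U. *)
pose tau1 := Num.sqrt (U%:R / 8) / r.
have tau1E : tau1 ^+ 2 = U%:R / 8 / r ^+ 2.
  by rewrite /tau1 expr_div_n sqr_sqrtr //; lra.
have tau10 : 0 < tau1 by rewrite divr_gt0 // sqrtr_gt0; lra.
(* The rate (1 + be) / r = U / (32 r) maximises tau r / 2 - 8 tau^2 r^2 / U. On a jump beyond r / 2,
   the share be / r yields the factor expR (- (be / 2)) and the remaining 1 / r dominates the fourth
   power. *)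
pose be : R := U%:R / 32 - 1.
have be0 : 0 <= be by rewrite /be; lra.
have tb0 : 0 <= (1 + be) / r by rewrite divr_ge0 ?ltW //; lra.
have E1 := avg_abs_mgf l lamP s0 (ltW tau10).
have E2 := avg_abs_mgf l lamP s0 tb0.
apply: le_trans (_ : _ <= 64 / tau1 ^+ 2 * f ^+ 2 *
   (\sum_(t : {ffun 'I_s -> I}) (\prod_k lam (t k)) * expR (tau1 * `|mix lam l - avg t l|))
  + (4 * 256) * r ^+ 4 * expR (- (be / 2)) *
   (\sum_(t : {ffun 'I_s -> I}) (\prod_k lam (t k)) * expR ((1 + be) / r * `|mix lam l - avg t l|))) _.
  rewrite !mulr_sumr -big_split /=; apply: ler_sum => t _.
  rewrite [X in _ <= X + _]mulrCA [X in _ <= _ + X]mulrCA -mulrDr.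
  apply: ler_wpM2l; first exact: weights_ge0.
  have := excess_dist f (avg t l) r0; rewrite -/f; set e := `|f - avg t l|.
  move=> h; apply: le_trans h _; have e0 : 0 <= e by exact: normr_ge0.
  apply: lerD.
    have : (tau1 * e) ^+ 2 <= 4 * expR (tau1 * e) by rewrite expR_ge_sqr // mulr_ge0 // ltW.
    rewrite exprMn => h.
    have -> : 64 / tau1 ^+ 2 * f ^+ 2 * expR (tau1 * e) =
      16 * f ^+ 2 / tau1 ^+ 2 * (4 * expR (tau1 * e)) by ring.
    have -> : 16 * e ^+ 2 * f ^+ 2 = 16 * f ^+ 2 / tau1 ^+ 2 * (tau1 ^+ 2 * e ^+ 2).
      by field; rewrite gt_eqF.
    by rewrite ler_wpM2l // divr_ge0 ?sqr_ge0 // mulr_ge0 ?sqr_ge0.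
  have [re|_] := ltP (r / 2) e; last first.
    rewrite mulr0; apply: mulr_ge0; last exact: expR_ge0.
    by apply: mulr_ge0; [apply: mulr_ge0; [lra | exact: exprn_ge0 (ltW r0)] | exact: expR_ge0].
  rewrite mulr1 -[_ * expR _ * expR _]mulrA -expRD.
  have er0 : 0 <= e / r by rewrite divr_ge0 // ltW.
  have h1 := expR_ge_pow4 er0.
  have -> : 4 * e ^+ 4 = 4 * (r ^+ 4 * (e / r) ^+ 4) by field; rewrite gt_eqF.
  set y := expR (_ + _); have -> : 4 * 256 * r ^+ 4 * y = 4 * (r ^+ 4 * (256 * y)) by ring.
  rewrite ler_pM2l // ler_wpM2l // ?exprn_ge0 ?(ltW r0) //.
  apply: le_trans h1 _; apply: ler_wpM2l; rewrite /y ?ler_expR; first lra.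
  have : 1/2 <= e / r by rewrite ler_pdivlMr //; lra.
  have -> : - (be / 2) + (1 + be) / r * e = e / r + be * (e / r - 1/2).
    by field; rewrite gt_eqF.
  by move=> ?; rewrite lerDl mulr_ge0 // subr_ge0.
have tau8 : 8 * tau1 ^+ 2 * M ^+ 2 / s%:R = 1.
  by rewrite -[_ / s%:R]mulrA Msr tau1E; field; rewrite Un0 rn0.
have b8 : 8 * ((1 + be) / r) ^+ 2 * M ^+ 2 / s%:R = U%:R / 128.
  by rewrite -[_ / s%:R]mulrA Msr /be; field; rewrite Un0 rn0.
rewrite tau8 in E1; rewrite b8 in E2.
have e4 := expR1_le4 R.
rewrite [X in _ <= X]addrC.
set rU := 2 ^+ 21 * r ^+ 2 / U%:R.
have r2 : 0 < r ^+ 2 by rewrite exprn_gt0.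
apply: lerD.
  have -> : rU * f ^+ 2 = 64 / tau1 ^+ 2 * f ^+ 2 * 2 ^+ 12.
    by rewrite /rU tau1E; field; rewrite Un0 rn0.
  apply: ler_wpM2l; last by apply: le_trans E1 _; lra.
  by rewrite mulr_ge0 ?sqr_ge0 // divr_ge0 ?sqr_ge0.
clear tau8 b8 E1 be0 tb0.
(* The jump term is left with expR (1/2) q^2: one factor q absorbs r^2 <= M^2, which is where [MU]
   is used, and the other absorbs U. *)
pose q := expR (- (U%:R / 256) : R).
have q0 : 0 < q by exact: expR_gt0.
have qE : expR (U%:R / 256) * q = 1 by rewrite -expRD subrr expR0.
have rq : r ^+ 2 * q <= 1.
  rewrite -[X in _ <= X]qE ler_pM2r //; apply: le_trans MU.
  by rewrite ler_pXn2r ?nnegrE // ltW.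
have Uq : U%:R * q <= 256.
  have : U%:R / 256 * q <= 1.
    rewrite -[X in _ <= X]qE ler_pM2r //; apply: le_trans (expR_ge1Dx _).
    by rewrite lerDr.
  lra.
have e2 : expR (1/2) <= 4 :> R by apply: le_trans e4; rewrite ler_expR; lra.
have eb : expR (- (be / 2)) * expR (U%:R / 128) = expR (1/2) * q ^+ 2.
  by rewrite -expRD /q -expRM_natl -expRD; congr expR; rewrite /be; field.
apply: le_trans (_ : _ <= 4 * 256 * r ^+ 4 * expR (- (be / 2)) * (2 * expR (U%:R / 128))) _.
  apply: ler_wpM2l E2; apply: mulr_ge0; last exact: expR_ge0.
  by apply: mulr_ge0; [lra | exact: exprn_ge0 (ltW r0)].
have -> : 4 * 256 * r ^+ 4 * expR (- (be / 2)) * (2 * expR (U%:R / 128)) =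
   2 * 4 * 256 * r ^+ 2 * (expR (1/2) * ((r ^+ 2 * q) * q)).
  have -> : 4 * 256 * r ^+ 4 * expR (- (be / 2)) * (2 * expR (U%:R / 128)) =
    2 * 4 * 256 * r ^+ 4 * (expR (- (be / 2)) * expR (U%:R / 128)) by ring.
  by rewrite eb; ring.
rewrite /rU ler_pdivlMr; last lra.
set c := 2 * 4 * 256 * r ^+ 2; set w := expR (1/2).
have -> : 2 ^+ 21 * r ^+ 2 = c * (4 * 256) by rewrite /c; ring.
have -> : c * (w * (r ^+ 2 * q * q)) * U%:R = c * (w * ((r ^+ 2 * q) * (U%:R * q))) by ring.
have c0 : 0 <= c by apply: mulr_ge0 (ltW r2); lra.
have rq0 : 0 <= r ^+ 2 * q := mulr_ge0 (ltW r2) (ltW q0).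
have Uq0 : 0 <= U%:R * q := mulr_ge0 (ler0n R U) (ltW q0).
apply: (ler_wpM2l c0); apply: (ler_pM _ _ e2); first exact: expR_ge0.
  exact: mulr_ge0.
by rewrite -[256]mul1r; apply: ler_pM.
Qed.

End Maurey.

(** * Chaining the Rademacher process over the scales *)

Lemma union_bound (R : realType) (K E : finType) (w : E -> R) (P : K -> pred E) :
  (forall e, 0 <= w e) ->
  \sum_(e | [exists k, P k e]) w e <= \sum_k \sum_(e | P k e) w e.
Proof.
move=> w0; under [leRHS]eq_bigr do rewrite big_mkcond /=.
rewrite exchange_big /= big_mkcond /=; apply: ler_sum => e _.
case: ifPn => [/existsP[k Pk]|_]; last by apply: sumr_ge0 => k _; case: ifP.
by rewrite (bigD1 k) //= Pk lerDl; apply: sumr_ge0 => k' _; case: ifP.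
Qed.

Lemma excess_halve (R : realType) (r x : R) : 0 <= r ->
  0 <= excess r x - excess (2 * r) x <= 3 * r ^+ 2.
Proof.
move=> r0; have r2 := sqr_ge0 r; rewrite /excess exprMn.
by case: (leP (x ^+ 2 - r ^+ 2)) => h1; case: (leP (x ^+ 2 - _)) => h2;
  apply/andP; split; lra.
Qed.

Section Chaining.
Context {R : realType} {I L : finType} (v : I -> L -> R) (M : R) (U J : nat).
Hypothesis vM : forall i l, `|v i l| <= M.
Hypothesis M0 : 0 < M.
Hypothesis U64 : (64 <= U)%N.
Hypothesis MU : M ^+ 2 <= expR (U%:R / 256).
Variables (x x' : R).
Hypotheses (x0 : 0 < x) (x'0 : 0 < x').
Variables (ell leps : R).
Hypotheses (ell0 : 0 <= ell) (leps0 : 0 <= leps).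

Let r j : R := M / 2 ^+ j.
Let s j : nat := (4 ^ j * U)%N.
(* In lamb j the first summand is matched to the entropy (s j + s j.+1) * ell,
   the second one to leps. *)
Let lamb j : R := x / M ^+ 2 * (s j.+1)%:R + x' / M / r j.+1.
Let T j : R := (s j + s j.+1)%:R * ell + leps.

Let sgsum (e : {ffun L -> bool}) (a : L -> R) : R := \sum_l (-1) ^+ e l * a l.

Definition increment j (t : {ffun 'I_(4 ^ j * U) -> I})
    (t' : {ffun 'I_(4 ^ j.+1 * U) -> I}) (l : L) : R :=
  excess (M / 2 ^+ j.+1) (avg v t' l) - excess (M / 2 ^+ j) (avg v t l).

(** Only averages of dictionary elements occur, not [lam]: these are finitely many conditions, open
    to a union bound, and they then serve the whole hull at once. *)
Definition good_signs e := forall j t t', (j < J)%N ->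
  `|sgsum e (increment (j := j) t t')| <=
  2 * lamb j * (\sum_l increment t t' l ^+ 2) + T j / lamb j.

Let r0 j : 0 < r j. Proof. by rewrite divr_gt0 // exprn_gt0. Qed.
Let rS j : r j = 2 * r j.+1.
Proof. by rewrite /r exprS; field; rewrite expf_neq0. Qed.
Let rM j : r j <= M.
Proof. by rewrite ler_pdivrMr ?exprn_gt0 // ler_peMr ?(ltW M0) // exprn_ege1 // ler1n. Qed.
Let sr j : (s j)%:R * r j ^+ 2 = M ^+ 2 * U%:R.
Proof.
rewrite /s /r natrM natrX expr_div_n -exprM mulnC exprM (_ : 2 ^+ 2 = 4%:R); last by ring.
by field; rewrite expf_neq0 // pnatr_eq0.
Qed.
Let s0 j : (0 < s j)%N.
Proof. by rewrite muln_gt0 expn_gt0 /=; apply: leq_trans U64. Qed.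
Let U0 : 64 <= U%:R :> R. Proof. by rewrite ler_nat. Qed.
Let lamb0 j : 0 < lamb j.
Proof.
rewrite addr_gt0 //; first by rewrite mulr_gt0 ?ltr0n ?s0 // divr_gt0 ?exprn_gt0.
by rewrite !divr_gt0.
Qed.

Lemma bad_signs_count :
  \sum_(e : {ffun L -> bool} | ~~ `[< good_signs e >]) 1 <=
  \sum_(j < J) (#|I|%:R ^+ (s j + s j.+1) * (2 * expR (- T j) * 2 ^+ #|L|)).
Proof.
pose P (j : 'I_J) (e : {ffun L -> bool}) :=
  [exists t : {ffun 'I_(s j) -> I} * {ffun 'I_(s j.+1) -> I},
    2 * lamb j * (\sum_l increment t.1 t.2 l ^+ 2) + T j / lamb j <
    `|sgsum e (increment t.1 t.2)|].
apply: le_trans (_ : _ <= \sum_(e | [exists j, P j e]) 1) _.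
  rewrite big_mkcond [leRHS]big_mkcond; apply: ler_sum => e _.
  case: ifPn => [/asboolPn bad|_]; last by case: ifP.
  case: ifPn => // /existsPn h; exfalso; apply: bad => j t t' jJ.
  have /existsPn /(_ (t, t')) := h (Ordinal jJ).
  by rewrite /= -leNgt.
apply: le_trans (union_bound _ _) _ => //; apply: ler_sum => j _.
apply: le_trans (union_bound _ _) _ => //.
apply: le_trans (ler_sum _ (fun t _ => rademacher_tail (increment t.1 t.2) (T j) (lamb0 j))) _.
rewrite sumr_const card_prod !card_ffun !card_ord -expnD -[leLHS]mulr_natr natrX mulrC.
exact: lexx.
Qed.

Section Deterministic.
Variables (e : {ffun L -> bool}) (lam : I -> R).
Hypotheses (ge : good_signs e) (lamP : simplex lam).

Let f := mix v lam.
Let A : R := #|L|%:R + \sum_l f l ^+ 2.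
Let F j l := excess (r j) (f l).
Let Cm : R := 2 ^+ 21.
Let W j := \sum_l (F j.+1 l - F j l).

Let f20 : 0 <= \sum_l f l ^+ 2.
Proof. by apply: sumr_ge0 => l _; exact: sqr_ge0. Qed.
Let A0 : 0 <= A. Proof. by rewrite addr_ge0 ?ler0n. Qed.

Let halve j l : 0 <= F j.+1 l - F j l <= 3 * r j.+1 ^+ 2.
Proof. by rewrite /F (rS j); apply: excess_halve; exact: ltW. Qed.

Let W0 j : 0 <= W j.
Proof. by apply: sumr_ge0 => l _; case/andP: (halve j l). Qed.

Let WA j : W j <= A.
Proof.
apply: le_trans (_ : _ <= \sum_l f l ^+ 2) _; last by rewrite lerDr ler0n.
apply: ler_sum => l _; apply: le_trans (excess_le (r j.+1) (f l)).
by rewrite lerBlDr lerDl excess_ge0.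
Qed.

Let sumW : \sum_(0 <= j < J) W j <= A.
Proof.
rewrite exchange_big /=; apply: le_trans (_ : _ <= \sum_l f l ^+ 2) _; last by rewrite lerDr ler0n.
apply: ler_sum => l _; rewrite telescope_sumr //; apply: le_trans (excess_le (r J) (f l)).
by rewrite lerBlDr lerDl excess_ge0.
Qed.

Let sum_r : \sum_(0 <= j < J) r j.+1 <= M.
Proof.
rewrite (eq_bigr (fun j => - r j.+1 - - r j)) => [|j _]; last by rewrite (rS j); ring.
rewrite telescope_sumr // opprK /r expr0 divr1 addrC.
by rewrite lerBlDr lerDl; apply: ltW; exact: r0.
Qed.

Let ex_t j : exists t : {ffun 'I_(s j) -> I},
  \sum_l (F j l - excess (r j) (avg v t l)) ^+ 2 <= Cm * r j ^+ 2 / U%:R * A.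
Proof. exact: maurey. Qed.

Let t j := projT1 (cid (ex_t j)).
Let G j l := excess (r j) (avg v (t j) l).
Let tP j : \sum_l (F j l - G j l) ^+ 2 <= Cm * r j ^+ 2 / U%:R * A.
Proof. exact: projT2 (cid (ex_t j)). Qed.

(** At scale 0 the threshold is M itself, which no average exceeds, so the chain starts from
    zero. *)
Let G0 l : G 0%N l = 0.
Proof. by apply: excess0; rewrite /r expr0 divr1; apply: norm_avg => //; exact: ltW. Qed.

(** The increment is an increment b of the excess of f itself plus two Maurey errors. Since 0 <= b
    <= 3 r^2, its square is at most 3 r^2 b, which makes the energy linear in [W j] and hence
    summable over j. The 15 is 3 + 3 * 4, because r j = 2 r j.+1. *)
Let step_sq j : \sum_l (G j.+1 l - G j l) ^+ 2 <=
  r j.+1 ^+ 2 * (15 * Cm * (A / U%:R) + 9 * W j).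
Proof.
apply: le_trans (_ : _ <= \sum_l (3 * (F j.+1 l - G j.+1 l) ^+ 2 +
   9 * r j.+1 ^+ 2 * (F j.+1 l - F j l) + 3 * (F j l - G j l) ^+ 2)) _.
  apply: ler_sum => l _; have /andP[h1 h2] := halve j l.
  set a := F j.+1 l - G j.+1 l; set b := F j.+1 l - F j l in h1 h2 *.
  set c := F j l - G j l.
  have -> : G j.+1 l - G j l = - a + b + c by rewrite /a /b /c; ring.
  have h3 : b ^+ 2 <= 3 * r j.+1 ^+ 2 * b by rewrite expr2 ler_wpM2r.
  have := sqr_ge0 (a + b); have := sqr_ge0 (a + c); have := sqr_ge0 (b - c).
  rewrite -[9 * _ * b]mulrA; move: h3; rewrite -[3 * _ * b]mulrA; move: (r j.+1 ^+ 2 * b) => d.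
  clearbody a b c. lra.
rewrite !big_split /= -!mulr_sumr -/(W j).
have h1 := tP j.+1; have h2 := tP j.
have -> : r j.+1 ^+ 2 * (15 * Cm * (A / U%:R) + 9 * W j) =
  3 * (Cm * r j.+1 ^+ 2 / U%:R * A) + 9 * r j.+1 ^+ 2 * W j + 3 * (Cm * r j ^+ 2 / U%:R * A).
  by rewrite (rS j); ring.
lra.
Qed.

Let AU : A / U%:R <= A.
Proof.
have U1 : 1 <= U%:R :> R by apply: le_trans U0; rewrite ler1n.
by rewrite ler_pdivrMr ?ler_peMr // (lt_le_trans _ U1).
Qed.

(** Here lamb j * r j.+1 ^ 2 = x U + x' r j.+1 / M. The factor U of the first summand cancels
    against A / U in the Maurey part and survives only in front of [W j], whose sum over j stays
    below A. *)
Let step_bound j : (j < J)%N -> `|sgsum e (fun l => G j.+1 l - G j l)| <=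
  2 * x * (15 * Cm * A + 9 * U%:R * W j) + 2 * x' / M * r j.+1 * (15 * Cm + 9) * A
  + 2 * ell * M ^+ 2 / x + leps * M / x' * r j.+1.
Proof.
move=> jJ; apply: le_trans (ge (t j) (t j.+1) jJ) _.
have rj := r0 j.+1; have lj := lamb0 j.
have sj : 0 < (s j.+1)%:R :> R by rewrite ltr0n s0.
have M20 : 0 < M ^+ 2 by rewrite exprn_gt0.
rewrite -addrA; apply: lerD.
  apply: le_trans (_ : _ <= 2 * lamb j * (r j.+1 ^+ 2 * (15 * Cm * (A / U%:R) + 9 * W j))) _.
    by apply: ler_wpM2l (step_sq j); apply: mulr_ge0 => //; apply: ltW.
  have -> : 2 * lamb j * (r j.+1 ^+ 2 * (15 * Cm * (A / U%:R) + 9 * W j)) =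
    2 * (lamb j * r j.+1 ^+ 2) * (15 * Cm * (A / U%:R) + 9 * W j) by ring.
  have -> : lamb j * r j.+1 ^+ 2 = x * U%:R + x' / M * r j.+1.
    rewrite /lamb mulrDl -mulrA sr; field; rewrite ?(gt_eqF M0) ?(gt_eqF rj) //.
  have -> : 2 * (x * U%:R + x' / M * r j.+1) * (15 * Cm * (A / U%:R) + 9 * W j) =
    2 * x * (15 * Cm * A + 9 * U%:R * W j) +
    2 * (x' / M * r j.+1) * (15 * Cm * (A / U%:R) + 9 * W j).
    by field; rewrite (gt_eqF M0) gt_eqF // ltr0n; apply: leq_trans U64.
  rewrite lerD2l.
  have -> : 2 * x' / M * r j.+1 * (15 * Cm + 9) * A = 2 * (x' / M * r j.+1) * ((15 * Cm + 9) * A) by ring.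
  apply: ler_wpM2l; first by rewrite mulr_ge0 // mulr_ge0 ?ltW // divr_gt0.
  have C0 : 0 <= 15 * Cm by rewrite mulr_ge0 // exprn_ge0.
  have := WA j; have := ler_wpM2l C0 AU; lra.
(* Each part of [T j] is compared with its own summand of [lamb j]: the entropy costs 2 ell M^2 / x
   at every scale, [leps] only a multiple of r j.+1, and these scales sum to at most M. *)
rewrite ler_pdivrMr // mulrDl.
have TE : T j <= 2 * (s j.+1)%:R * ell + leps.
  apply: lerD => //; apply: ler_wpM2r => //.
  rewrite natrD mulr_natl mulr2n; apply: lerD => //; rewrite ler_nat.
  by rewrite leq_pmul2r; [rewrite leq_exp2l | apply: leq_trans U64].
apply: le_trans TE _; apply: lerD.
  apply: le_trans (_ : _ <= 2 * ell * M ^+ 2 / x * (x / M ^+ 2 * (s j.+1)%:R)) _.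
    by rewrite le_eqVlt; apply/orP; left; apply/eqP; field; rewrite !gt_eqF.
  apply: ler_wpM2l; first by rewrite divr_ge0 ?(ltW x0) // !mulr_ge0 ?(ltW M0).
  by rewrite lerDl !divr_ge0 ?ltW.
apply: le_trans (_ : _ <= leps * M / x' * r j.+1 * (x' / M / r j.+1)) _.
  by rewrite le_eqVlt; apply/orP; left; apply/eqP; field; rewrite !gt_eqF.
apply: ler_wpM2l; first by rewrite mulr_ge0 ?(ltW rj) // divr_ge0 ?(ltW x'0) // mulr_ge0 ?(ltW M0).
by rewrite lerDr mulr_ge0 ?divr_ge0 ?(ltW M20) ?(ltW x0).
Qed.

Lemma chaining_bound : `|sgsum e (fun l => f l ^+ 2)| <=
  (r J ^+ 2 + Cm * r J) * A + 2 * x * (15 * Cm * J%:R + 9 * U%:R) * A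
  + 2 * x' * (15 * Cm + 9) * A + 2 * J%:R * ell * M ^+ 2 / x + leps * M ^+ 2 / x'.
Proof.
have rJ := r0 J.
have sgD (a b : L -> R) : sgsum e (fun l => a l + b l) = sgsum e a + sgsum e b.
  by rewrite /sgsum -big_split; apply: eq_bigr => l _; rewrite mulrDr.
have sg_abs (a : L -> R) : `|sgsum e a| <= \sum_l `|a l|.
  apply: le_trans (ler_norm_sum _ _ _) _; apply: ler_sum => l _.
  by rewrite normrM normrX normrN1 expr1n mul1r.
(* What lies below the last scale, the last Maurey error, and the chain. The first two are small
   without any cancellation between signs. *)
have -> : sgsum e (fun l => f l ^+ 2) = sgsum e (fun l => f l ^+ 2 - F J l) +
    sgsum e (fun l => F J l - G J l) +
    \sum_(0 <= j < J) sgsum e (fun l => G j.+1 l - G j l).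
  rewrite /sgsum exchange_big /= -!big_split /=; apply: eq_bigr => l _.
  rewrite -mulr_sumr telescope_sumr // G0 subr0 -!mulrDr; congr (_ * _); ring.
have mA : #|L|%:R <= A by rewrite lerDl.
have h1 : `|sgsum e (fun l => f l ^+ 2 - F J l)| <= r J ^+ 2 * A.
  apply: le_trans (sg_abs _) _.
  apply: le_trans (_ : _ <= \sum_(l : L) r J ^+ 2) _.
    apply: ler_sum => l _; rewrite ger0_norm ?subr_ge0 ?excess_le //.
    by rewrite lerBlDr -lerBlDl /F /excess le_max lexx.
  by rewrite sumr_const -[leLHS]mulr_natr ler_wpM2l // exprn_ge0 // ltW.
have h2 : `|sgsum e (fun l => F J l - G J l)| <= Cm * r J * A.
  apply: le_trans (sg_abs _) _.
  (* The inequality |a| <= a^2 / (2 r) + r / 2 passes from the squared Maurey error to the sum of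
     absolute values. *)
  apply: le_trans (_ : _ <= \sum_l ((F J l - G J l) ^+ 2 * (2 * r J)^-1 + r J / 2)) _.
    apply: ler_sum => l _; set a := _ - _.
    rewrite -(ler_pM2r (_ : 0 < 2 * r J)); last by rewrite mulr_gt0.
    have -> : (a ^+ 2 * (2 * r J)^-1 + r J / 2) * (2 * r J) = a ^+ 2 + r J ^+ 2.
      by field; rewrite gt_eqF.
    by rewrite -real_normK ?num_real //; have := sqr_ge0 (`|a| - r J); lra.
  have -> : \sum_l ((F J l - G J l) ^+ 2 / (2 * r J) + r J / 2) =
      (\sum_l (F J l - G J l) ^+ 2) / (2 * r J) + r J / 2 * #|L|%:R.
    by rewrite big_split /= -mulr_suml sumr_const mulr_natr.
  have h : (\sum_l (F J l - G J l) ^+ 2) * (2 * r J)^-1 <= Cm * r J / 2 * A.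
    rewrite ler_pdivrMr; last by rewrite mulr_gt0.
    apply: le_trans (tP J) _.
    have -> : Cm * r J ^+ 2 / U%:R * A = Cm * r J ^+ 2 * (A / U%:R) by ring.
    have -> : Cm * r J / 2 * A * (2 * r J) = Cm * r J ^+ 2 * A by field.
    by apply: ler_wpM2l AU; rewrite mulr_ge0 ?exprn_ge0 ?(ltW rJ).
  have mA' : r J / 2 * #|L|%:R <= r J / 2 * A.
    by apply: ler_wpM2l mA; rewrite divr_ge0 // ltW.
  apply: le_trans (lerD h mA') _.
  have C1 : 1 <= Cm by rewrite exprn_ege1 // ler1n.
  have : 0 <= (Cm - 1) * (r J * A) by rewrite mulr_ge0 ?subr_ge0 // mulr_ge0 // ltW.
  lra.
have h3 : `|\sum_(0 <= j < J) sgsum e (fun l => G j.+1 l - G j l)| <=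
  2 * x * (15 * Cm * J%:R + 9 * U%:R) * A
  + 2 * x' * (15 * Cm + 9) * A + 2 * J%:R * ell * M ^+ 2 / x + leps * M ^+ 2 / x'.
  apply: le_trans (ler_norm_sum _ _ _) _.
  apply: le_trans (_ : _ <= \sum_(0 <= j < J) ((2 * x * (15 * Cm * A) + 2 * ell * M ^+ 2 / x)
     + 18 * x * U%:R * W j + (2 * x' / M * (15 * Cm + 9) * A + leps * M / x') * r j.+1)) _.
    rewrite big_nat_cond [leRHS]big_nat_cond; apply: ler_sum => j /andP[/= jJ _].
    by apply: le_trans (step_bound jJ) _; rewrite le_eqVlt; apply/orP; left; apply/eqP; ring.
  have sumE (c1 c2 c3 : R) (w u : nat -> R) : \sum_(0 <= j < J) (c1 + c2 * w j + c3 * u j) =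
      c1 *+ J + c2 * (\sum_(0 <= j < J) w j) + c3 * (\sum_(0 <= j < J) u j).
    by rewrite !big_split /= -!mulr_sumr sumr_const_nat subn0.
  rewrite sumE.
  have k1 : 18 * x * U%:R * \sum_(0 <= j < J) W j <= 18 * x * U%:R * A.
    by apply: ler_wpM2l sumW; rewrite !mulr_ge0 ?(ltW x0).
  have C0 : 0 <= 15 * Cm + 9 by rewrite addr_ge0 // mulr_ge0 // exprn_ge0.
  have k2 : (2 * x' / M * (15 * Cm + 9) * A + leps * M / x') * \sum_(0 <= j < J) r j.+1
     <= (2 * x' / M * (15 * Cm + 9) * A + leps * M / x') * M.
    have M00 := ltW M0; have x'00 := ltW x'0.
    apply: ler_wpM2l sum_r; apply: addr_ge0; last by rewrite divr_ge0 // mulr_ge0.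
    by rewrite mulr_ge0 // mulr_ge0 // divr_ge0 // mulr_ge0.
  apply: le_trans (lerD (lerD (lexx _) k1) k2) _.
  by rewrite -[_ *+ J]mulr_natr le_eqVlt; apply/orP; left; apply/eqP; field; rewrite !gt_eqF.
apply: le_trans (ler_normD _ _) _; apply: le_trans (lerD (ler_normD _ _) (lexx _)) _.
move: h1 h2 h3; set a1 := `|_|; set a2 := `|_|; set a3 := `|_|; lra.
Qed.
End Deterministic.
End Chaining.

(** * Choice of the chaining parameters *)

Lemma expR1_ge2 (R : realType) : 2 <= expR 1 :> R.
Proof. by have := expR_ge1Dx (1 : R); lra. Qed.

Lemma geometric_half (R : realType) n : \sum_(j < n) (1/2) ^+ j.+1 <= 1 :> R.
Proof.
suff -> : \sum_(j < n) (1/2) ^+ j.+1 = 1 - (1/2) ^+ n :> R.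
  by rewrite lerBlDr lerDl exprn_ge0.
elim: n => [|n IH]; first by rewrite big_ord0 expr0 subrr.
by rewrite big_ord_recr IH /= exprS; field.
Qed.

Lemma ln_pow2_le (R : realType) n : ln (2 ^+ n) <= n%:R :> R.
Proof.
rewrite -[leRHS]expRK ler_ln ?posrE ?exprn_gt0 ?expR_gt0 //.
by rewrite -[n%:R]mulr1 expRM_natl lerXn2r ?nnegrE ?expR_ge0 // expR1_ge2.
Qed.

(** The factor e inside the entropy term beats the number of pairs of tuples by e^-k with k >= j.+1,
    so the scales contribute a geometric series; the 2 in ln (2 / eps) cancels the 2 of the
    two-sided tail. *)
Lemma bad_signs_le (R : realType) (I L : finType) (v : I -> L -> R) (M : R) (U J : nat)
    (x x' eps : R) :
  (forall i l, `|v i l| <= M) -> 0 < M -> (64 <= U)%N ->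
  0 < x -> 0 < x' -> (0 < #|I|)%N -> 0 < eps ->
  \sum_(e | ~~ `[< good_signs v M U J x x' (ln (expR 1 * #|I|%:R)) (ln (2 / eps)) e >]) 1
  <= eps * 2 ^+ #|L|.
Proof.
move=> vM M0 U64 x0 x'0 I0 eps0.
apply: le_trans (bad_signs_count _ _ _ _ _ _ _ _) _ => //.
rewrite -[leRHS]mul1r; apply: le_trans (_ : _ <= (\sum_(j < J) (1/2) ^+ j.+1) * (eps * 2 ^+ #|L|)) _; last first.
  by apply: ler_wpM2r (geometric_half R J); rewrite mulr_ge0 ?exprn_ge0 // ltW.
rewrite mulr_suml; apply: ler_sum => j _.
set k := (_ + _)%N.
have jk : (j.+1 <= k)%N.
  rewrite /k (leq_trans _ (leq_addl _ _)) //.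
  apply: leq_trans (_ : 4 ^ j.+1 <= _)%N; first exact: ltnW (ltn_expl _ _).
  by rewrite leq_pmulr // (leq_trans _ U64).
have IR : 0 < #|I|%:R :> R by rewrite ltr0n.
rewrite opprD expRD -mulrN expRM_natl expRN lnK ?posrE ?mulr_gt0 ?expR_gt0 //.
rewrite expRN lnK ?posrE ?divr_gt0 // invf_div.
have -> : #|I|%:R ^+ k * (2 * ((expR 1 * #|I|%:R)^-1 ^+ k * (eps / 2)) * 2 ^+ #|L|) =
  (#|I|%:R / (expR 1 * #|I|%:R)) ^+ k * (eps * 2 ^+ #|L|).
  by rewrite exprMn; field.
apply: ler_wpM2r; first by rewrite mulr_ge0 ?exprn_ge0 // ltW.
have e2 := expR1_ge2 R.
have -> : #|I|%:R / (expR 1 * #|I|%:R) = (expR 1)^-1 :> R.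
  by field; rewrite !gt_eqF // expR_gt0.
have h : (expR 1)^-1 <= 1/2 :> R.
  by rewrite div1r lef_pV2 ?posrE ?expR_gt0.
apply: le_trans (_ : _ <= (1/2) ^+ k) _.
  by rewrite lerXn2r ?nnegrE ?invr_ge0 ?expR_ge0.
by apply: ler_wiXn2l => //; lra.
Qed.

(** Of the relative error kap, the first term of [chaining_bound] receives kap / 4 and the other
    four kap / 8 each. The two terms that are not proportional to A are paid from the lower bound on
    #|L|, which A dominates. *)
Lemma rademacher_process (R : realType) (I L : finType) (v : I -> L -> R) (M kap eps : R) :
  (forall i l, `|v i l| <= M) -> 1 <= M -> 0 < kap -> kap <= 1 ->
  (0 < #|I|)%N -> 0 < eps -> eps <= 1 ->
  2 ^+ 47 * kap ^- 2 * M ^+ 2 *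
    (ln (expR 1 * #|I|%:R) * ln (expR 1 * (M ^+ 2 / kap)) ^+ 2 + ln (2 / eps)) <= #|L|%:R ->
  \sum_(e : {ffun L -> bool} | `[< exists2 lam, simplex lam &
      kap * (#|L|%:R + \sum_l mix v lam l ^+ 2) <
      `|\sum_l (-1) ^+ e l * mix v lam l ^+ 2| >]) 1 <= eps * 2 ^+ #|L|.
Proof.
move=> vM M1 k0 k1 I0 eps0 eps1 mL.
have M0 : 0 < M by apply: lt_le_trans M1.
have M21 : 1 <= M ^+ 2 by rewrite exprn_ege1.
have M20 : 0 < M ^+ 2 by apply: lt_le_trans M21.
set Lg := ln (expR 1 * (M ^+ 2 / kap)) in mL.
have Mk0 : 0 < M ^+ 2 / kap by rewrite divr_gt0.
have LgE : Lg = 1 + ln (M ^+ 2 / kap) by rewrite /Lg lnM ?posrE ?expR_gt0 // expRK.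
have Mk1 : M ^+ 2 <= M ^+ 2 / kap by rewrite ler_pdivlMr // ler_piMr // ltW.
have lnM2 : 0 <= ln (M ^+ 2) by rewrite ln_ge0.
have lnMk : ln (M ^+ 2) <= ln (M ^+ 2 / kap) by rewrite ler_ln ?posrE.
have Lg1 : 1 <= Lg by lra.
have Lg0 : 0 < Lg by lra.
(* The order of magnitude at which M^2 <= expR (U / 256) becomes available; it stays within a
   constant multiple of [Lg]. *)
pose U := (64 + (Num.truncn (256 * ln (M ^+ 2))).+1)%N.
have U64 : (64 <= U)%N by rewrite leq_addr.
have tU : 0 <= 256 * ln (M ^+ 2) by rewrite mulr_ge0 ?ler0n.
have /andP[tU1 tU2] := truncn_itv tU.
have MU : M ^+ 2 <= expR (U%:R / 256).
  rewrite -[leLHS]lnK ?posrE // ler_expR ler_pdivlMr ?ltr0n // mulrC.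
  by rewrite /U natrD; apply: le_trans (ltW tU2) _; rewrite lerDr.
have UL : U%:R <= 2 ^+ 9 * Lg.
  by rewrite /U natrD -natr1; lra.
(* Once y <= 2^J, the last scale M / 2^J is below kap / 2^24, small enough for its square plus 2^21
   times itself to be at most kap / 4. *)
pose y := 2 ^+ 24 * (M / kap).
clearbody U; have yE : y = 2 ^+ 24 * (M / kap) by [].
have Mkk0 : 0 < M / kap by rewrite divr_gt0.
have y0 : 0 < y by rewrite mulr_gt0 ?exprn_gt0.
have y1 : 1 <= y.
  rewrite -[1]mulr1; apply: ler_pM => //; first by rewrite exprn_ege1 // ler1n.
  by rewrite ler_pdivlMr //; lra.
clearbody y; pose J := (Num.truncn (2 * ln y)).+1.
have tJ : 0 <= 2 * ln y by rewrite mulr_ge0 // ln_ge0.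
have /andP[tJ1 tJ2] := truncn_itv tJ.
have yJ : y <= 2 ^+ J.
  have : expR (ln y) <= expR (J%:R * (1/2)) by rewrite ler_expR /J; lra.
  rewrite lnK ?posrE // expRM_natl => /le_trans; apply.
  by rewrite lerXn2r ?nnegrE ?expR_ge0 // expR_half_le2.
have JL : J%:R <= 2 ^+ 6 * Lg.
  have : ln y <= 24%:R + ln (M ^+ 2 / kap).
    rewrite yE lnM ?posrE ?exprn_gt0 //; apply: lerD; first exact: ln_pow2_le.
    by rewrite ler_ln ?posrE // ler_pM2r ?invr_gt0 // expr2 ler_peMr // ltW.
  rewrite /J -natr1; move: tJ1 LgE Lg1; clear; lra.
clearbody J.
(* Both rates spend kap / 8 on their terms proportional to A. In the entropy term 1 / x then
   contributes one factor [Lg] and J the other: this is the squared logarithm. *)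
pose x := kap / (2 ^+ 36 * Lg); pose x' := kap / 2 ^+ 29.
have x0 : 0 < x by rewrite divr_gt0 // mulr_gt0 // exprn_gt0.
have x'0 : 0 < x' by rewrite divr_gt0 // exprn_gt0.
set ell := ln (expR 1 * _) in mL.
set leps := ln _ in mL.
have ell0 : 0 <= ell.
  have I1 : 1 <= #|I|%:R :> R by rewrite ler1n.
  by have e2 := expR1_ge2 R; rewrite ln_ge0 //; move: e2 I1; clear; nra.
have leps0 : 0 <= leps.
  by rewrite ln_ge0 // ler_pdivlMr // mul1r; lra.
apply: le_trans (bad_signs_le J vM M0 U64 x0 x'0 I0 eps0).
rewrite big_mkcond [leRHS]big_mkcond; apply: ler_sum => e _.
case: asboolP => [[lam lamP bad]|_]; last by case: ifP.
case: asboolP => //= ge; exfalso; move: bad; apply/negP; rewrite -leNgt.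
apply: le_trans (chaining_bound vM M0 U64 MU x0 x'0 ell0 leps0 ge lamP) _.
set A := _ + \sum_l _.
have mA : #|L|%:R <= A by rewrite lerDl; apply: sumr_ge0 => l _; exact: sqr_ge0.
have A0 : 0 <= A by apply: le_trans mA.
have rJ : M / 2 ^+ J <= kap / 2 ^+ 24.
  rewrite ler_pdivrMr ?exprn_gt0 //.
  apply: le_trans (_ : _ <= kap / 2 ^+ 24 * y) _.
    rewrite le_eqVlt; apply/orP; left; apply/eqP; by rewrite yE; field; rewrite gt_eqF.
  rewrite ler_pM2l // divr_gt0 ?exprn_gt0 //.
have r0 : 0 < M / 2 ^+ J by rewrite divr_gt0 ?exprn_gt0.
have b1 : (M / 2 ^+ J) ^+ 2 + 2 ^+ 21 * (M / 2 ^+ J) <= kap / 4.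
  have : (M / 2 ^+ J) ^+ 2 <= M / 2 ^+ J.
    rewrite expr2 ler_piMl ?(ltW r0) //; apply: le_trans rJ _.
    by rewrite ler_pdivrMr ?exprn_gt0 // mul1r; apply: le_trans k1 _; rewrite exprn_ege1 // ler1n.
  move: rJ r0; set r := M / _ => rJ r0; lra.
have b2 : 2 * x * (15 * 2 ^+ 21 * J%:R + 9 * U%:R) <= kap / 8.
  apply: le_trans (_ : _ <= 2 * x * (2 ^+ 32 * Lg)) _.
    by apply: ler_wpM2l; [rewrite mulr_ge0 // ltW | lra].
  have -> : 2 * x * (2 ^+ 32 * Lg) = kap / 8 by rewrite /x; field; rewrite gt_eqF.
  exact: lexx.
have b3 : 2 * x' * (15 * 2 ^+ 21 + 9) <= kap / 8 by rewrite /x'; lra.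
have k20 : 0 < kap ^+ 2 by rewrite exprn_gt0.
have mL' : 2 ^+ 47 * M ^+ 2 * (ell * Lg ^+ 2) + 2 ^+ 47 * M ^+ 2 * leps <= kap ^+ 2 * #|L|%:R.
  rewrite -mulrDr [leRHS]mulrC -ler_pdivrMr //; apply: le_trans mL.
  by rewrite le_eqVlt; apply/orP; left; apply/eqP; ring.
have eL0 : 0 <= M ^+ 2 * (ell * Lg ^+ 2) by rewrite mulr_ge0 ?(ltW M20) // mulr_ge0 ?sqr_ge0.
have le0 : 0 <= M ^+ 2 * leps by rewrite mulr_ge0 ?(ltW M20).
have b4 : 2 * J%:R * ell * M ^+ 2 / x <= kap * #|L|%:R / 8.
  apply: le_trans (_ : _ <= 2 * (2 ^+ 6 * Lg) * ell * M ^+ 2 / x) _.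
    rewrite ler_pM2r ?invr_gt0 // ler_pM2r // ler_wpM2r //; lra.
  have -> : 2 * (2 ^+ 6 * Lg) * ell * M ^+ 2 / x = 2 ^+ 43 * M ^+ 2 * (ell * Lg ^+ 2) / kap.
    by rewrite /x; field; rewrite !gt_eqF.
  by rewrite ler_pdivrMr //; lra.
have b5 : leps * M ^+ 2 / x' <= kap * #|L|%:R / 8.
  have -> : leps * M ^+ 2 / x' = 2 ^+ 29 * M ^+ 2 * leps / kap.
    by rewrite /x'; field; rewrite gt_eqF.
  by rewrite ler_pdivrMr //; lra.
have b6 : kap * #|L|%:R <= kap * A by apply: ler_wpM2l mA; apply: ltW.
apply: le_trans (lerD (lerD (lerD (lerD (ler_wpM2r A0 b1) (ler_wpM2r A0 b2))
  (ler_wpM2r A0 b3)) b4) b5) _.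
have kA0 : 0 <= kap * A by rewrite mulr_ge0 // ltW.
by move: kA0 b6; clear; lra.
Qed.

(** * Samples from a finite probability space and symmetrization *)

Section ProductWeights.
Context {R : realType} {Q L : finType} (p : Q -> R).
Hypothesis pP : simplex p.

Definition pweight (k : {ffun L -> Q}) : R := \prod_l p (k l).

Lemma pweight_ge0 k : 0 <= pweight k.
Proof. by case: pP => p0 _; apply: prodr_ge0. Qed.

Lemma sum_pweight : \sum_k pweight k = 1.
Proof.
by case: pP => _ p1; rewrite -(bigA_distr_bigA (fun _ q => p q)) /= big1.
Qed.

Lemma pweight_second_moment (X : Q -> R) : \sum_q p q * X q = 0 ->
  \sum_k pweight k * (\sum_l X (k l)) ^+ 2 = #|L|%:R * \sum_q p q * X q ^+ 2.
Proof.
case: pP => _ p1 X0.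
(* Writing X (k l) as a product over all coordinates lets the sum over [k] factor into one sum per
   coordinate. *)
have pick (l : L) (k : {ffun L -> Q}) : \prod_j (if j == l then X (k j) else 1) = X (k l).
  by rewrite -big_mkcond big_pred1_eq.
have cov (l l' : L) : \sum_k pweight k * (X (k l) * X (k l')) =
    (l == l')%:R * \sum_q p q * X q ^+ 2.
  under eq_bigr => k _.
    rewrite -[X (k l)]pick -[X (k l')]pick /pweight -!big_split /=.
    over.
  rewrite -(bigA_distr_bigA (fun j q => p q *
    ((if j == l then X q else 1) * (if j == l' then X q else 1)))) /=.
  rewrite (bigD1 l) //= eqxx; have [<-|ll'] := eqVneq l l'.
    rewrite [X in _ * X]big1 ?mulr1 ?mul1r // => j /negPf ->.
    by under eq_bigr do rewrite !mulr1.
  by under eq_bigr do rewrite mulr1; rewrite X0 !mul0r.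
under eq_bigr => k _.
  rewrite expr2 mulr_suml mulr_sumr.
  under eq_bigr => l _ do rewrite mulr_sumr mulr_sumr.
  over.
rewrite exchange_big /=; under eq_bigr => l _.
  rewrite exchange_big /=; under eq_bigr => l' _ do rewrite cov.
  rewrite -mulr_suml (bigD1 l) //= eqxx big1 ?addr0 ?mul1r; last first.
    by move=> j /negPf jl; rewrite eq_sym jl.
  over.
by rewrite sumr_const mulr_natl.
Qed.

Lemma pweight_chebyshev (X : Q -> R) (tau : R) : 0 < tau -> \sum_q p q * X q = 0 ->
  \sum_(k : {ffun L -> Q} | tau < `|\sum_l X (k l)|) pweight k <=
  #|L|%:R * (\sum_q p q * X q ^+ 2) / tau ^+ 2.
Proof.
move=> tau0 X0; rewrite -pweight_second_moment // ler_pdivlMr ?exprn_gt0 //.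
rewrite mulr_suml [leRHS](bigID (fun k : {ffun L -> Q} => tau < `|\sum_l X (k l)|)) /=.
apply: ler_wpDr; first by apply: sumr_ge0 => k _; rewrite mulr_ge0 ?pweight_ge0 ?sqr_ge0.
apply: ler_sum => k /ltW tk; apply: ler_wpM2l; first exact: pweight_ge0.
by rewrite -[leRHS]real_normK ?num_real // lerXn2r ?nnegrE // ltW.
Qed.

Definition swap (e : {ffun L -> bool}) (kk : {ffun L -> Q} * {ffun L -> Q}) :
    {ffun L -> Q} * {ffun L -> Q} :=
  ([ffun l => if e l then kk.2 l else kk.1 l], [ffun l => if e l then kk.1 l else kk.2 l]).

Lemma swapK e : involutive (swap e).
Proof.
by case=> k k'; rewrite /swap /=; congr (_, _); apply/ffunP => l; rewrite !ffunE; case: (e l).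
Qed.

Lemma pweight_swap e kk :
  pweight (swap e kk).1 * pweight (swap e kk).2 = pweight kk.1 * pweight kk.2.
Proof.
rewrite /pweight -!big_split /=; apply: eq_bigr => l _; rewrite !ffunE.
by case: (e l) => //; rewrite mulrC.
Qed.

(** Each swap is an involution preserving the product weight, so the probability of [B] is unchanged
    by it; averaging over all swaps leaves, for each fixed pair of samples, a count of sign
    vectors. *)
Lemma swap_average (B : pred ({ffun L -> Q} * {ffun L -> Q})) :
  2 ^+ #|L| * \sum_(kk | B kk) pweight kk.1 * pweight kk.2 =
  \sum_kk pweight kk.1 * pweight kk.2 * \sum_(e : {ffun L -> bool} | B (swap e kk)) 1.
Proof.
transitivity (\sum_(e : {ffun L -> bool}) \sum_(kk | B (swap e kk)) pweight kk.1 * pweight kk.2).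
  rewrite [RHS](eq_bigr (fun=> \sum_(kk | B kk) pweight kk.1 * pweight kk.2)).
    by rewrite sumr_const card_ffun card_bool -[RHS]mulr_natl natrX.
  move=> e _; rewrite [RHS](reindex_inj (inv_inj (@swapK e))) /=.
  by apply: eq_big => [kk|kk _]; rewrite ?swapK ?pweight_swap.
under eq_bigr do rewrite big_mkcond /=.
rewrite exchange_big /=; apply: eq_bigr => kk _.
by rewrite mulr_sumr [RHS]big_mkcond /=; apply: eq_bigr => e _; rewrite mulr1.
Qed.

End ProductWeights.

Definition second_moment (R : realType) (I Q : finType) (p : Q -> R)
  (v : I -> Q -> R) (lam : I -> R) : R := \sum_q p q * mix v lam q ^+ 2.

(** Budget of the failure probability: eps / 4 of the sign vectors for each of the two samples,
    doubled when the ghost sample is removed. The relative error passes from d to d / 16 for the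
    signs. *)
Lemma sampling_deviation (R : realType) (I Q L : finType) (p : Q -> R)
    (v : I -> Q -> R) (M d eps : R) :
  simplex p -> (forall i q, `|v i q| <= M) ->
  1 <= M -> 0 < d -> d <= 1 -> (0 < #|I|)%N -> 0 < eps -> eps <= 1 ->
  2 ^+ 60 * d ^- 2 * M ^+ 2 *
    (ln (expR 1 * #|I|%:R) * ln (expR 1 * (M ^+ 2 / d)) ^+ 2 + ln (2 / eps)) <= #|L|%:R ->
  \sum_(k : {ffun L -> Q} | `[< exists2 lam, simplex lam &
      d * Num.max 1 (second_moment p v lam) * #|L|%:R <
      `|\sum_l mix v lam (k l) ^+ 2 - #|L|%:R * second_moment p v lam| >]) pweight p k <= eps.
Proof.
move=> pP vM M1 d0 d1 I0 eps0 eps1 mL.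
pose pop := second_moment p v.
pose emp (k : {ffun L -> Q}) lam := \sum_l mix v lam (k l) ^+ 2.
set m : R := #|L|%:R in mL *.
have M0 : 0 < M by apply: lt_le_trans M1.
have d20 : 0 < d ^+ 2 by rewrite exprn_gt0.
have M20 : 0 < M ^+ 2 by rewrite exprn_gt0.
set ell := ln (expR 1 * _) in mL; set Lg := ln (expR 1 * _) in mL; set leps := ln _ in mL.
have N1 : 1 <= #|I|%:R :> R by rewrite ler1n.
have ell1 : 1 <= ell.
  rewrite /ell lnM ?posrE ?expR_gt0 ?ltr0n // expRK lerDl ln_ge0 //.
have Md0 : 0 < M ^+ 2 / d by rewrite divr_gt0.
have Lg1 : 1 <= Lg.
  rewrite /Lg lnM ?posrE ?expR_gt0 // expRK lerDl ln_ge0 //.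
  rewrite ler_pdivlMr // mul1r; apply: le_trans d1 _; exact: exprn_ege1.
have ln2le : ln 2 <= leps.
  rewrite /leps ler_ln ?posrE ?divr_gt0 // ler_pdivlMr //; lra.
have ln20 : 0 <= ln 2 :> R by rewrite ln_ge0 ?ler1n.
have leps0 : 0 <= leps by apply: le_trans ln2le.
have eL1 : 1 <= ell * Lg ^+ 2.
  by rewrite -[1]mulr1; apply: ler_pM => //; rewrite exprn_ege1.
have mL' : 2 ^+ 60 * (M ^+ 2 * (ell * Lg ^+ 2)) + 2 ^+ 60 * (M ^+ 2 * leps) <= m * d ^+ 2.
  rewrite -ler_pdivrMr //; apply: le_trans mL.
  by rewrite le_eqVlt; apply/orP; left; apply/eqP; ring.
have Ml0 : 0 <= M ^+ 2 * leps by rewrite mulr_ge0 // ltW.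
have MM : M ^+ 2 <= M ^+ 2 * (ell * Lg ^+ 2) by rewrite ler_peMr // ltW.
have m0 : 0 < m.
  rewrite -(pmulr_lgt0 _ d20); apply: lt_le_trans mL'.
  by move: MM Ml0 M20; clear; lra.
have mcheb : 8 * M ^+ 2 <= d ^+ 2 * m by move: MM Ml0 M20 mL'; clear; lra.
pose core (k : {ffun L -> Q}) (e : {ffun L -> bool}) := `[< exists2 lam, simplex lam &
      d / 16 * (m + emp k lam) < `|\sum_l (-1) ^+ e l * mix v lam (k l) ^+ 2| >].
have coreP k : \sum_(e | core k e) 1 <= eps / 4 * 2 ^+ #|L|.
  have mixk lam l : mix (fun i l => v i (k l)) lam l = mix v lam (k l) by [].
  apply: (@rademacher_process R I L (fun i l => v i (k l)) M (d / 16) (eps / 4)) => //.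
  - by rewrite divr_gt0.
  - by move: d1; clear; lra.
  - by rewrite divr_gt0.
  - by move: eps1; clear; lra.
  have -> : M ^+ 2 / (d / 16) = 2 ^+ 4 * (M ^+ 2 / d) by field; rewrite gt_eqF.
  have -> : 2 / (eps / 4) = 2 ^+ 2 * (2 / eps) by field; rewrite gt_eqF.
  have lE : ln (expR 1 * (2 ^+ 4 * (M ^+ 2 / d))) = ln (2 ^+ 4) + Lg.
    by rewrite mulrCA lnM // ?posrE ?exprn_gt0 // mulr_gt0 ?expR_gt0.
  have l1 : ln (expR 1 * (2 ^+ 4 * (M ^+ 2 / d))) <= 5 * Lg.
    by rewrite lE; have := ln_pow2_le R 4; move: (ln (2 ^+ 4)) Lg1 => z; clear; lra.
  have l10 : 0 <= ln (expR 1 * (2 ^+ 4 * (M ^+ 2 / d))).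
    rewrite lE; apply: addr_ge0; last by apply: le_trans Lg1.
    by rewrite ln_ge0 // exprn_ege1 // ler1n.
  have l2 : ln (2 ^+ 2 * (2 / eps)) <= 3 * leps.
    have -> : ln (2 ^+ 2 * (2 / eps)) = 2 * ln 2 + leps.
      by rewrite lnM // ?posrE ?exprn_gt0 ?divr_gt0 // lnXn // [2 * ln 2]mulr_natl.
    by move: ln2le; clear; lra.
  have l3 : ln (expR 1 * (2 ^+ 4 * (M ^+ 2 / d))) ^+ 2 <= 25 * Lg ^+ 2.
    have -> : 25 * Lg ^+ 2 = (5 * Lg) ^+ 2 by ring.
    by rewrite lerXn2r ?nnegrE // (le_trans l10).
  have -> : (d / 16) ^- 2 = 2 ^+ 8 * d ^- 2 by field; rewrite gt_eqF.
  have ell0 : 0 <= ell by move: ell1; clear; lra.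
  apply: le_trans (_ : _ <= 2 ^+ 47 * (2 ^+ 8 * d ^- 2) * M ^+ 2 *
    (ell * (25 * Lg ^+ 2) + 3 * leps)) _.
    apply: ler_wpM2l; last by apply: lerD => //; apply: ler_wpM2l.
    apply: mulr_ge0; last exact: ltW.
    by apply: mulr_ge0; [|apply: mulr_ge0; [|rewrite invr_ge0 ltW]]; rewrite ?exprn_ge0.
  rewrite -/m -(ler_pM2r d20).
  have -> : 2 ^+ 47 * (2 ^+ 8 * d ^- 2) * M ^+ 2 * (ell * (25 * Lg ^+ 2) + 3 * leps) * d ^+ 2 =
    2 ^+ 55 * 25 * (M ^+ 2 * (ell * Lg ^+ 2)) + 2 ^+ 55 * 3 * (M ^+ 2 * leps).
    by field; rewrite gt_eqF.
  by move: mL' MM Ml0 M20; clear; lra.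

pose bad2 (kk : {ffun L -> Q} * {ffun L -> Q}) := `[< exists2 lam, simplex lam &
  d / 16 * (2 * m + (emp kk.1 lam + emp kk.2 lam)) < `|emp kk.1 lam - emp kk.2 lam| >].
(* A swap preserves emp kk.1 + emp kk.2 and turns their difference into a difference of two sign
   sums, one per sample, with the same signs; for a bad pair one of them must violate its own
   bound. *)
have swap_bad kk : \sum_(e | bad2 (swap e kk)) 1 <= eps / 2 * 2 ^+ #|L|.
  apply: le_trans (_ : _ <= \sum_(e | core kk.1 e) 1 + \sum_(e | core kk.2 e) 1) _; last first.
    by apply: le_trans (lerD (coreP _) (coreP _)) _; rewrite -mulrDl; apply: ler_wpM2r;
      [rewrite exprn_ge0 | clear; lra].
  rewrite [leLHS]big_mkcond [X in _ <= X + _]big_mkcond [X in _ <= _ + X]big_mkcond -big_split /=; apply: ler_sum => e _.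
  case: ifPn => [/asboolP[lam lamP h]|_]; last by apply: addr_ge0; case: ifP.
  case: ifPn => [_|/asboolPn h1]; first by rewrite lerDl; case: ifP.
  case: ifPn => [_|/asboolPn h2]; first by rewrite lerDr.
  exfalso; move: h; apply/negP; rewrite -leNgt.
  have {}h1 : `|\sum_l (-1) ^+ e l * mix v lam (kk.1 l) ^+ 2| <= d / 16 * (m + emp kk.1 lam).
    by rewrite leNgt; apply/negP => h; apply: h1; exists lam.
  have {}h2 : `|\sum_l (-1) ^+ e l * mix v lam (kk.2 l) ^+ 2| <= d / 16 * (m + emp kk.2 lam).
    by rewrite leNgt; apply/negP => h; apply: h2; exists lam.
  have -> : emp (swap e kk).1 lam - emp (swap e kk).2 lam =
      \sum_l (-1) ^+ e l * mix v lam (kk.1 l) ^+ 2 - \sum_l (-1) ^+ e l * mix v lam (kk.2 l) ^+ 2.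
    rewrite /emp -!sumrB; apply: eq_bigr => l _; rewrite !ffunE.
    by case: (e l); rewrite ?expr1 ?expr0; ring.
  have -> : emp (swap e kk).1 lam + emp (swap e kk).2 lam = emp kk.1 lam + emp kk.2 lam.
    rewrite /emp -!big_split /=; apply: eq_bigr => l _; rewrite !ffunE.
    by case: (e l) => //; rewrite addrC.
  apply: le_trans (ler_normB _ _) _; apply: le_trans (lerD h1 h2) _.
  by rewrite le_eqVlt; apply/orP; left; apply/eqP; ring.
have bad2_le : \sum_(kk | bad2 kk) pweight p kk.1 * pweight p kk.2 <= eps / 2.
  have two0 : 0 < 2 ^+ #|L| :> R by rewrite exprn_gt0.
  rewrite -(ler_pM2l two0) swap_average //.
  apply: le_trans (_ : _ <= \sum_kk pweight p kk.1 * pweight p kk.2 * (eps / 2 * 2 ^+ #|L|)) _.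
    by apply: ler_sum => kk _; apply: ler_wpM2l => //; rewrite mulr_ge0 ?pweight_ge0.
  rewrite -mulr_suml -(pair_big predT predT (fun k k' => pweight p k * pweight p k')) /=.
  under eq_bigr do rewrite -mulr_sumr sum_pweight // mulr1.
  by rewrite sum_pweight // mul1r mulrC.
(* The variance is at most M^2 A, so by Chebyshev the deviation z' of the ghost sample is at most d
   A m / 2 with probability at least 1/2, whereas |z| > d A m. Then |z| - |z'| exceeds d A m / 4 +
   (|z| + |z'|) / 16, which dominates the threshold of [bad2]. *)
have half k lam : simplex lam -> d * Num.max 1 (pop lam) * m < `|emp k lam - m * pop lam| ->
    1/2 <= \sum_(k' | bad2 (k, k')) pweight p k'.
  move=> lamP; set A := Num.max _ _ => bk.
  have [p0 p1] := pP.
  have A1 : 1 <= A by rewrite /A le_max lexx.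
  have Apop : pop lam <= A by rewrite /A le_max lexx orbT.
  have pop0 : 0 <= pop lam by apply: sumr_ge0 => q _; rewrite mulr_ge0 ?sqr_ge0.
  have A0 : 0 < A by apply: lt_le_trans A1.
  pose X q := mix v lam q ^+ 2 - pop lam.
  have X0 : \sum_q p q * X q = 0.
    rewrite /X; under eq_bigr do rewrite mulrBr.
    by rewrite sumrB -mulr_suml p1 mul1r subrr.
  have XE (k' : {ffun L -> Q}) : \sum_l X (k' l) = emp k' lam - m * pop lam.
    by rewrite /X sumrB sumr_const -[pop lam *+ _]mulr_natl.
  have XV : \sum_q p q * X q ^+ 2 <= M ^+ 2 * A.
    apply: le_trans (_ : _ <= M ^+ 2 * pop lam - pop lam ^+ 2) _; last first.
      have h := ler_wpM2l (ltW M20) Apop; have := sqr_ge0 (pop lam).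
      by move: h; clear; lra.
    have -> : M ^+ 2 * pop lam - pop lam ^+ 2 = \sum_q p q *
        (M ^+ 2 * mix v lam q ^+ 2 - 2 * pop lam * mix v lam q ^+ 2 + pop lam ^+ 2).
      under [RHS]eq_bigr => q _.
        rewrite (_ : p q * _ = (M ^+ 2 - 2 * pop lam) * (p q * mix v lam q ^+ 2) + pop lam ^+ 2 * p q); last by ring.
        over.
      rewrite big_split /= -!mulr_sumr p1 -/(second_moment p v lam) -/(pop lam); ring.
    apply: ler_sum => q _; apply: ler_wpM2l => //.
    have f2 : mix v lam q ^+ 2 <= M ^+ 2.
      rewrite -real_normK ?num_real // lerXn2r ?nnegrE ?(ltW M0) //; exact: norm_mix.
    have := ler_wpM2r (sqr_ge0 (mix v lam q)) f2.
    by rewrite /X; clear; lra.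
  have tau0 : 0 < d / 2 * A * m by rewrite mulr_gt0 // mulr_gt0 // divr_gt0.
  have ch := pweight_chebyshev pP tau0 X0.
  have ch2 : #|L|%:R * (\sum_q p q * X q ^+ 2) / (d / 2 * A * m) ^+ 2 <= 1/2.
    rewrite ler_pdivrMr ?exprn_gt0 // -/m.
    apply: le_trans (_ : _ <= m * (M ^+ 2 * A)) _; first by rewrite ler_pM2l.
    have -> : 1 / 2 * (d / 2 * A * m) ^+ 2 = m * (A * (A * (d ^+ 2 * m)) / 8) by field.
    rewrite ler_pM2l // ler_pdivlMr // mulrAC mulrC ler_pM2l // mulrC.
    apply: le_trans mcheb _; rewrite ler_peMl // mulr_ge0 ?ltW //.
  have ch3 := le_trans (ch L) ch2.
  have : \sum_(k' : {ffun L -> Q}) pweight p k' = 1 by exact: sum_pweight.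
  rewrite (bigID (fun k' : {ffun L -> Q} => d / 2 * A * m < `|\sum_l X (k' l)|)) /= => tot.
  apply: le_trans (_ : _ <= \sum_(k' : {ffun L -> Q} | ~~ (d / 2 * A * m < `|\sum_l X (k' l)|)) pweight p k') _.
    by move: tot ch3; clear; lra.
  rewrite big_mkcond [leRHS]big_mkcond; apply: ler_sum => k' _.
  case: ifPn => [|_]; last by case: ifP => // _; exact: pweight_ge0.
  rewrite -leNgt XE => bk'.
  suff -> : bad2 (k, k') by [].
  apply/asboolP; exists lam => //=.
  set z := emp k lam - m * pop lam in bk; set z' := emp k' lam - m * pop lam in bk'.
  have -> : emp k lam - emp k' lam = z - z' by rewrite /z /z'; ring.
  have -> : emp k lam + emp k' lam = 2 * (m * pop lam) + z + z' by rewrite /z /z'; ring.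
  have h1 : m <= A * m by rewrite ler_peMl // ltW.
  have h2 : m * pop lam <= A * m by rewrite mulrC ler_wpM2r // ltW.
  have h3 : `|z| - `|z'| <= `|z - z'| by exact: lerB_dist.
  apply: lt_le_trans h3.
  apply: le_lt_trans (_ : _ <= d / 16 * (4 * (A * m) + (`|z| + `|z'|))) _.
    apply: ler_wpM2l; first by rewrite divr_ge0 ?ltW.
    by have := ler_norm z; have := ler_norm z'; move: h1 h2; clear; lra.
  have h4 : d * (`|z| + `|z'|) <= `|z| + `|z'| by rewrite ler_piMl // addr_ge0.
  by move: bk bk' h4 tau0; clear; lra.
have key : \sum_(k : {ffun L -> Q} | `[< exists2 lam, simplex lam &
      d * Num.max 1 (pop lam) * m < `|emp k lam - m * pop lam| >]) pweight p k * (1/2) <=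
   \sum_(kk | bad2 kk) pweight p kk.1 * pweight p kk.2.
  rewrite -(pair_big_dep predT (fun k k' => bad2 (k, k')) (fun k k' => pweight p k * pweight p k')) /=.
  rewrite big_mkcond; apply: ler_sum => k _; rewrite -mulr_sumr.
  case: ifPn => [/asboolP[lam lamP bk]|_].
    by apply: ler_wpM2l; [exact: pweight_ge0 | exact: half lamP bk].
  by rewrite mulr_ge0 ?pweight_ge0 //; apply: sumr_ge0 => k' _; exact: pweight_ge0.
have := le_trans key bad2_le; rewrite -mulr_suml.
by rewrite /emp /pop; move: (\sum_(k | _) _) => s; clear; lra.
Qed.

(** * From a convex hull to an l1 ball *)

Lemma sum_pair_bool (R : realType) (I : finType) (F : I * bool -> R) :
  \sum_js F js = \sum_j (F (j, true) + F (j, false)).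
Proof.
rewrite (eq_bigr (fun js => F (js.1, js.2))) => [|[? ?] _] //.
rewrite -(pair_bigA _ (fun j s => F (j, s))) /=; apply: eq_bigr => j _.
by rewrite big_bool.
Qed.

Section SignedDictionary.
Context {R : realType} {K Q : finType} (u : K -> Q -> R) (B : R).
Hypotheses (B0 : 0 < B) (K0 : (0 < #|K|)%N).

(** These are the images of the vertices of the l1 ball of radius [B], which turns the ball of
    coefficients into a simplex. *)
Definition signed_dict (js : K * bool) (q : Q) : R := (-1) ^+ js.2 * B * u js.1 q.

(* The unused mass is spread evenly over u j and - u j, where it cancels. *)
Definition signed_weight (a : K -> R) (js : K * bool) : R :=
  (`|a js.1| + (-1) ^+ js.2 * a js.1) / (2 * B) +
  (1 - (\sum_j `|a j|) / B) / (2 * #|K|%:R).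

Let K0' : #|K|%:R != 0 :> R. Proof. by rewrite pnatr_eq0 -lt0n. Qed.

Lemma signed_weight_simplex a : \sum_j `|a j| <= B -> simplex (signed_weight a).
Proof.
move=> aB; split=> [[j s]|].
  rewrite addr_ge0 // divr_ge0 ?mulr_ge0 ?(ltW B0) ?ler0n //=.
    by case: s; rewrite ?expr0 ?expr1 ?mul1r ?mulN1r;
      have := ler_norm (a j); have := ler_norm (- a j); rewrite normrN; lra.
  by rewrite subr_ge0 ler_pdivrMr // mul1r.
rewrite sum_pair_bool /signed_weight /=.
rewrite (eq_bigr (fun j => `|a j| / B + (1 - (\sum_j `|a j|) / B) / #|K|%:R)); last first.
  by move=> j _; field; rewrite K0' gt_eqF.
by rewrite big_split /= -mulr_suml sumr_const -[_ *+ _]mulr_natr; field; rewrite K0' gt_eqF.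
Qed.

Lemma mix_signed a q : mix signed_dict (signed_weight a) q = mix u a q.
Proof.
rewrite /mix sum_pair_bool; apply: eq_bigr => j _; rewrite /signed_weight /signed_dict /=.
by field; rewrite K0' gt_eqF.
Qed.

End SignedDictionary.

Lemma signed_sampling (R : realType) (K Q L : finType) (p : Q -> R)
    (u : K -> Q -> R) (B G d eps : R) :
  simplex p -> (forall j q, `|u j q| <= G) ->
  0 < B -> 1 <= B * G -> 0 < d -> d <= 1 -> (0 < #|K|)%N -> 0 < eps -> eps <= 1 ->
  2 ^+ 60 * d ^- 2 * (B * G) ^+ 2 *
    (ln (expR 1 * (#|K| * 2)%:R) * ln (expR 1 * ((B * G) ^+ 2 / d)) ^+ 2 + ln (2 / eps))
    <= #|L|%:R ->
  \sum_(k : {ffun L -> Q} | `[< exists2 a, \sum_j `|a j| <= B &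
      d * Num.max 1 (second_moment p u a) * #|L|%:R <
      `|\sum_l mix u a (k l) ^+ 2 - #|L|%:R * second_moment p u a| >]) pweight p k <= eps.
Proof.
move=> pP uG B0 BG1 d0 d1 K0 eps0 eps1 mL.
have KE : #|{: K * bool}| = (#|K| * 2)%N by rewrite card_prod card_bool.
have dictM js q : `|signed_dict u B js q| <= B * G.
  by rewrite /signed_dict !normrM normrX normrN1 expr1n mul1r gtr0_norm // ler_pM2l.
have := @sampling_deviation R (K * bool)%type Q L p (signed_dict u B) (B * G) d eps pP dictM.
rewrite KE => /(_ BG1 d0 d1); rewrite muln_gt0 K0 => /(_ isT eps0 eps1 mL).
apply: le_trans; rewrite big_mkcond [leRHS]big_mkcond; apply: ler_sum => k _.
case: ifPn => [/asboolP[a aB h]|_]; last by case: ifP => // _; exact: pweight_ge0.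
suff -> : `[< exists2 lam, simplex lam &
    d * Num.max 1 (second_moment p (signed_dict u B) lam) * #|L|%:R <
    `|\sum_l mix (signed_dict u B) lam (k l) ^+ 2 -
      #|L|%:R * second_moment p (signed_dict u B) lam| >] by [].
apply/asboolP; exists (signed_weight B a); first exact: signed_weight_simplex.
have mixE q : mix (signed_dict u B) (signed_weight B a) q = mix u a q by exact: mix_signed.
rewrite /second_moment; under eq_bigr do rewrite mixE.
by under [X in _ < `|X - _|]eq_bigr do rewrite mixE.
Qed.

(** * Rounding to a finite probability space *)

Lemma measure_finU d (T : measurableType d) (R : realType) (mu : {measure set T -> \bar R})
    (I : finType) (P : pred I) (F : I -> set T) :
  (forall i, measurable (F i)) -> trivIset setT F ->
  mu (\big[setU/set0]_(i | P i) F i) = (\sum_(i | P i) mu (F i))%E.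
Proof.
move=> mF tF; rewrite -big_filter -[RHS]big_filter.
have mU : measurable (\big[setU/set0]_(i <- [seq x <- index_enum I | P x]) F i).
  exact: bigsetU_measurable.
rewrite -[LHS]mul1e -(integral_cst mu mU 1) ge0_integral_bigsetU //.
- by apply: eq_bigr => i _; rewrite integral_cst // mul1e.
- by rewrite filter_uniq // index_enum_uniq.
- exact: sub_trivIset tF.
Qed.

Section Cells.
Context d {D : measurableType d} {R : realType} (mu : probability D R).
Context {K : finType} (g : K -> D -> R) (D0 : set D) (G : R) (n : nat).
Hypotheses (mD0 : measurable D0) (muD0 : mu D0 = 1%E).
Hypothesis mg : forall j, measurable_fun setT (g j).
Hypothesis gG : forall j x, D0 x -> `|g j x| <= G.
Hypotheses (G0 : 0 < G) (n0 : (0 < n)%N).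

Definition grid_coord (j : K) (x : D) : R := (g j x + G) * (n%:R / (2 * G)).

(** The coordinates fill the closed interval [0, n] while the cells are half open, so the top value
    n, reached where g j = G, needs an index of its own: hence ['I_n.+1]. *)
Definition cell (q : {ffun K -> 'I_n.+1}) : set D :=
  D0 `&` \bigcap_(j in [set: K]) [set x | (q j)%:R <= grid_coord j x < (q j).+1%:R].

Definition grid_value (j : K) (q : {ffun K -> 'I_n.+1}) : R :=
  - G + (q j)%:R * (2 * G / n%:R).

Let nR : 0 < n%:R :> R. Proof. by rewrite ltr0n. Qed.

Lemma measurable_cell q : measurable (cell q).
Proof.
apply: measurableI => //; apply: fin_bigcap_measurable; first exact: finite_finset.
move=> j _; rewrite [X in measurable X](_ : _ = grid_coord j @^-1` `[(q j)%:R, (q j).+1%:R[).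
  rewrite -[X in measurable X]setTI; apply: (_ : measurable_fun setT (grid_coord j)) => //.
  by apply: measurable_funM => //; apply: measurable_funD.
by apply/seteqP; split => x /=; rewrite in_itv.
Qed.

Lemma cell_disjoint : trivIset setT cell.
Proof.
move=> q q' _ _ [x [[_ h] [_ h']]]; apply/ffunP => j; apply: val_inj => /=.
have /= /andP[h1 h2] := h j I; have /= /andP[h3 h4] := h' j I.
have /le_lt_trans /(_ h4) := h1; have /le_lt_trans /(_ h2) := h3.
by rewrite !ltr_nat !ltnS => ? ?; apply/eqP; rewrite eqn_leq; apply/andP.
Qed.

Lemma cell_cover : D0 = \big[setU/set0]_q cell q.
Proof.
apply/seteqP; split => [x Dx|x].
  rewrite -(bigcup_pred predT) /=.
  have t0 j : 0 <= grid_coord j x.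
    rewrite mulr_ge0 ?divr_ge0 ?mulr_ge0 ?(ltW G0) ?ler0n //.
    by have := gG j Dx; rewrite ler_norml => /andP[]; lra.
  have tn j : (Num.truncn (grid_coord j x) < n.+1)%N.
    rewrite ltnS -(ler_nat R); have /andP[+ _] := truncn_itv (t0 j).
    move=> /le_trans; apply; rewrite /grid_coord mulrA ler_pdivrMr ?mulr_gt0 //.
    rewrite mulrC ler_pM2l //.
    by have := gG j Dx; rewrite ler_norml => /andP[]; lra.
  exists [ffun j => Ordinal (tn j)] => //; split => // j _ /=.
  by rewrite ffunE /= truncn_itv.
by rewrite -(bigcup_pred predT) => -[q _ []].
Qed.

Lemma cell_grid q x j : cell q x -> `|g j x - grid_value j q| <= 2 * G / n%:R.
Proof.
move=> [Dx /(_ j I) /= /andP[h1 h2]].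
have -> : g j x - grid_value j q = (grid_coord j x - (q j)%:R) * (2 * G / n%:R).
  by rewrite /grid_value /grid_coord; field; rewrite !gt_eqF.
have GN : 0 <= 2 * G / n%:R by rewrite divr_ge0 ?ler0n // mulr_ge0 // ltW.
rewrite normrM (ger0_norm GN) -[leRHS]mul1r; apply: ler_wpM2r => //.
rewrite ger0_norm; first by move: h2; rewrite -natr1; lra.
by rewrite subr_ge0.
Qed.

Lemma norm_grid_value j q : `|grid_value j q| <= G.
Proof.
have q0 : 0 <= (q j)%:R :> R by rewrite ler0n.
have qn : (q j)%:R <= n%:R :> R by rewrite ler_nat -ltnS.
have h : (q j)%:R * (2 * G / n%:R) <= 2 * G.
  by rewrite mulrA ler_pdivrMr // mulrC ler_pM2l // mulr_gt0.
have h0 : 0 <= (q j)%:R * (2 * G / n%:R).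
  by rewrite mulr_ge0 // divr_ge0 ?ler0n // mulr_ge0 // ltW.
by rewrite ler_norml /grid_value; apply/andP; split; lra.
Qed.

Section Combination.
Variables (B : R) (a : K -> R).
Hypothesis aB : \sum_j `|a j| <= B.

Let comb_bound (z : K -> R) c : 0 <= c -> (forall j, `|z j| <= c) -> `|\sum_j a j * z j| <= B * c.
Proof.
move=> c0 zc; apply: le_trans (ler_norm_sum _ _ _) _.
apply: le_trans (_ : _ <= \sum_j `|a j| * c) _.
  by apply: ler_sum => j _; rewrite normrM ler_wpM2l.
by rewrite -mulr_suml ler_wpM2r.
Qed.

Lemma cell_sqr q x : cell q x ->
  `|(\sum_j a j * g j x) ^+ 2 - mix grid_value a q ^+ 2| <= 4 * (B * G) ^+ 2 / n%:R.
Proof.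
move=> qx; have Dx : D0 x by case: qx.
have G00 := ltW G0.
rewrite subr_sqr normrM.
have -> : 4 * (B * G) ^+ 2 / n%:R = (B * (2 * G / n%:R)) * (2 * (B * G)) by ring.
apply: ler_pM => //.
  rewrite /mix -sumrB (eq_bigr (fun j => a j * (g j x - grid_value j q))) => [|j _]; last by ring.
  apply: comb_bound => [|j]; last exact: cell_grid.
  by rewrite divr_ge0 // mulr_ge0.
apply: le_trans (ler_normD _ _) _; rewrite mulr_natl mulr2n; apply: lerD; apply: comb_bound => // j.
  exact: gG.
exact: norm_grid_value.
Qed.

Let f x := (\sum_j a j * g j x) ^+ 2.
Let mf : measurable_fun setT f.
Proof.
apply: measurable_funX; apply: measurable_sum => j.
by apply: measurable_funM.
Qed.

Definition cell_mass q : R := fine (mu (cell q)).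

Lemma cell_massE q : mu (cell q) = (cell_mass q)%:E.
Proof. by rewrite /cell_mass fineK // fin_num_measure //; exact: measurable_cell. Qed.

Lemma integral_cells (h : D -> R) : measurable_fun setT h -> (forall x, 0 <= h x) ->
  (\int[mu]_(x in D0) (h x)%:E = \sum_q \int[mu]_(x in cell q) (h x)%:E)%E.
Proof.
move=> mh h0; rewrite [X in integral _ X](cell_cover) ge0_integral_bigsetU //.
- exact: measurable_cell.
- by rewrite index_enum_uniq.
- exact: sub_trivIset cell_disjoint.
- by apply/measurable_EFinP; apply: measurable_funTS.
- by move=> x _; rewrite lee_fin.
Qed.

Lemma cell_mass_simplex : simplex cell_mass.
Proof.
split=> [q|]; first by rewrite fine_ge0.
apply: EFin_inj; rewrite -sumEFin.
under eq_bigr do rewrite -cell_massE.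
by rewrite -muD0 [in RHS]cell_cover measure_finU //; [exact: measurable_cell|exact: cell_disjoint].
Qed.

Lemma integral_sqr_grid (eta : R) : 0 <= eta -> 4 * (B * G) ^+ 2 / n%:R <= eta ->
  exists2 h : R, (\int[mu]_(x in D0) (f x)%:E)%E = h%:E &
    [/\ 0 <= h, h <= second_moment cell_mass grid_value a + eta &
        second_moment cell_mass grid_value a <= h + eta].
Proof.
move=> eta0 Beta.
have f0 x : 0 <= f x by exact: sqr_ge0.
have cf q x : cell q x -> `|f x - mix grid_value a q ^+ 2| <= eta.
  by move=> qx; apply: le_trans Beta; exact: cell_sqr.
have [_ p1] := cell_mass_simplex.
have ub : (\int[mu]_(x in D0) (f x)%:E <= (second_moment cell_mass grid_value a + eta)%:E)%E.
  rewrite integral_cells //.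
  apply: (@le_trans _ _ (\sum_q ((mix grid_value a q ^+ 2 + eta) * cell_mass q)%:E)%E).
    apply: lee_sum => q _; rewrite EFinM -cell_massE -integral_cst //; last exact: measurable_cell.
    apply: ge0_le_integral => //=.
    - exact: measurable_cell.
    - by move=> x _; rewrite lee_fin.
    - by apply/measurable_EFinP; apply: measurable_funTS.
    - by move=> x qx; rewrite lee_fin; have := cf q x qx; rewrite ler_norml => /andP[]; lra.
  rewrite sumEFin lee_fin /second_moment -[X in _ <= _ + X]mulr1 -p1 mulr_sumr -big_split /=.
  by apply: ler_sum => q _; lra.
have lb : ((second_moment cell_mass grid_value a)%:E <= \int[mu]_(x in D0) (f x)%:E + eta%:E)%E.
  have -> : (\int[mu]_(x in D0) (f x)%:E + eta%:E = \int[mu]_(x in D0) (f x + eta)%:E)%E.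
    under [RHS]eq_integral do rewrite EFinD.
    rewrite ge0_integralD //.
    - by rewrite integral_cst // [X in (eta%:E * X)%E](_ : _ = 1%E) ?mule1.
    - by move=> x _; rewrite lee_fin.
    - by apply/measurable_EFinP; apply: measurable_funTS.
  rewrite integral_cells //; last by move=> x; rewrite addr_ge0.
    rewrite /second_moment -sumEFin; apply: lee_sum => q _.
    rewrite mulrC EFinM -cell_massE -integral_cst //; last exact: measurable_cell.
    apply: ge0_le_integral => //=.
    - exact: measurable_cell.
    - by move=> x _; rewrite lee_fin sqr_ge0.
    - by apply/measurable_EFinP; apply: measurable_funTS; apply: measurable_funD.
    - by move=> x qx; rewrite lee_fin; have := cf q x qx; rewrite ler_norml => /andP[]; lra.
  by apply: measurable_funD.
have I0 : (0 <= \int[mu]_(x in D0) (f x)%:E)%E by apply: integral_ge0 => x _; rewrite lee_fin.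
move: ub lb I0; case: (integral _ _ _) => [h||] //; rewrite -?EFinD ?lee_fin => ub lb h0.
by exists h.
Qed.
End Combination.
End Cells.

Lemma sampling_bounded d (D : measurableType d) (R : realType) (mu : probability D R)
    (K : finType) (g : K -> D -> R) (D0 : set D) (G B del eps : R) (m : nat)
    d' (Omega : measurableType d') (P : probability Omega R) (y : 'I_m -> {RV P >-> D}) :
  measurable D0 -> mu D0 = 1%E -> (forall j, measurable_fun setT (g j)) ->
  (forall j x, D0 x -> `|g j x| <= G) ->
  0 < G -> 0 < B -> 1 <= B * G -> 0 < del -> del <= 1 -> (0 < #|K|)%N -> 0 < eps -> eps <= 1 ->
  (forall (i : 'I_m) (A : set D), measurable A -> distribution P (y i) A = mu A) ->
  mutually_independent P y ->
  2 ^+ 60 * del ^- 2 * (B * G) ^+ 2 *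
    (ln (expR 1 * (#|K| * 2)%:R) * ln (expR 1 * ((B * G) ^+ 2 / del)) ^+ 2 + ln (2 / eps))
    <= m%:R ->
  exists E : set Omega, [/\ measurable E, ((1 - eps)%:E <= P E)%E &
    forall w, E w -> (forall i, D0 (y i w)) /\
      forall a : K -> R, \sum_j `|a j| <= B ->
      exists2 h, (\int[mu]_(x in D0) ((\sum_j a j * g j x) ^+ 2)%:E)%E = h%:E &
        `|\sum_i (\sum_j a j * g j (y i w)) ^+ 2 - m%:R * h| <= 2 * del * (1 + h) * m%:R].
Proof.
move=> mD0 muD0 mg gG G0 B0 BG1 del0 del1 K0 eps0 eps1 law indep mL.
have BG0 : 0 < B * G by rewrite mulr_gt0.
(* With n > z grid steps, rounding changes each square by at most del / 4, uniformly over the l1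
   ball. *)
pose z := 16 * (B * G) ^+ 2 / del.
have z0 : 0 <= z by rewrite divr_ge0 ?(ltW del0) // mulr_ge0 ?sqr_ge0.
pose n := (Num.truncn z).+1.
have n0 : (0 < n)%N by [].
have zn : z < n%:R by have /andP[_] := truncn_itv z0.
have nR : 0 < n%:R :> R by rewrite ltr0n.
have eta : 4 * (B * G) ^+ 2 / n%:R <= del / 4.
  rewrite ler_pdivrMr //.
  have -> : 4 * (B * G) ^+ 2 = del / 4 * z by rewrite /z; field; rewrite gt_eqF.
  by rewrite ler_pM2l ?divr_gt0 // ltW.
pose Q := {ffun K -> 'I_n.+1}.
pose C (q : Q) := cell g D0 G q.
pose p : Q -> R := cell_mass mu g D0 G (n := n).
pose u := grid_value G (K := K) (n := n).
have mC q : measurable (C q) by exact: measurable_cell.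
have pP : simplex p by exact: cell_mass_simplex.
pose bad (k : {ffun 'I_m -> Q}) := `[< exists2 a, \sum_j `|a j| <= B &
      del * Num.max 1 (second_moment p u a) * #|'I_m|%:R <
      `|\sum_l mix u a (k l) ^+ 2 - #|'I_m|%:R * second_moment p u a| >].
have badP : \sum_(k | bad k) pweight p k <= eps.
  apply: (@signed_sampling R K Q 'I_m p u B G del eps) => //; last by rewrite card_ord.
  by move=> j q; apply: norm_grid_value.
pose A (k : {ffun 'I_m -> Q}) : set Omega :=
  \bigcap_(i in [set` [set: 'I_m]%SET]) (y i @^-1` C (k i)).
have mA k : measurable (A k).
  apply: fin_bigcap_measurable; first exact: finite_finset.
  by move=> i _; rewrite -[X in measurable X]setTI; exact: measurable_funP.
have PA k : P (A k) = (pweight p k)%:E.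
  rewrite /A (indep [set: 'I_m]%SET (fun i => C (k i))) // /pweight -prodEFin.
  apply: eq_big => [i|i _]; first by rewrite finset.in_setT.
  by rewrite -[LHS]/(distribution P (y i) (C (k i))) law // /C cell_massE.
have tA : trivIset setT A.
  move=> k k' _ _ [w [h h']]; apply/ffunP => i.
  have hi : C (k i) (y i w) by apply: h; rewrite /= finset.in_setT.
  have hi' : C (k' i) (y i w) by apply: h'; rewrite /= finset.in_setT.
  apply: (@cell_disjoint _ _ _ _ g D0 G n) => //.
  by exists (y i w).
(* Each [A k] prescribes the cell of every sample point. Their union is measurable although the
   property is claimed for all [a], and by independence its probability is the total weight of the
   good tuples. *)
exists (\big[setU/set0]_(k | ~~ bad k) A k); split.
- by apply: bigsetU_measurable.
- rewrite measure_finU // (eq_bigr (fun k => (pweight p k)%:E)) => [|k _]; last exact: PA.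
  rewrite sumEFin lee_fin lerBlDr -(sum_pweight (L := 'I_m) pP).
  by rewrite [leLHS](bigID bad) /= addrC lerD2l.
move=> w; rewrite -(bigcup_pred (fun k => ~~ bad k)) => -[k /= gk Ak].
have Ck i : C (k i) (y i w) by apply: Ak; rewrite /= finset.in_setT.
split=> [i|a aB]; first by case: (Ck i).
have d40 : 0 <= del / 4 by rewrite divr_ge0 // ltW.
have [h hE [h0 h1 h2]] := integral_sqr_grid mD0 muD0 mg gG G0 n0 aB d40 eta.
exists h => //.
rewrite -/p -/u in h1 h2.
set s := second_moment p u a in h1 h2.
have gka : `|\sum_l mix u a (k l) ^+ 2 - m%:R * s| <= del * Num.max 1 s * m%:R.
  rewrite leNgt; apply/negP => bk; move: gk => /negP; apply; apply/asboolP; exists a => //.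
  by rewrite card_ord.
have emp : `|\sum_i (\sum_j a j * g j (y i w)) ^+ 2 - \sum_l mix u a (k l) ^+ 2| <= del / 4 * m%:R.
  rewrite -sumrB; apply: le_trans (ler_norm_sum _ _ _) _.
  apply: le_trans (_ : _ <= \sum_(i < m) del / 4) _.
    apply: ler_sum => i _; apply: le_trans eta.
    exact: (cell_sqr gG G0 n0 aB (Ck i)).
  by rewrite sumr_const card_ord -[leLHS]mulr_natr.
(* The grid moment [s] differs from [h] by at most del / 4. The two rounding errors, each at most a
   quarter of del (1 + h) m, fit into the factor 2 of the conclusion. *)
have max1 : Num.max 1 s <= 1 + h by rewrite ge_max; apply/andP; split; lra.
have m0 : 0 <= m%:R :> R by rewrite ler0n.
have b1 : del * Num.max 1 s * m%:R <= del * (1 + h) * m%:R.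
  by rewrite ler_wpM2r // ler_wpM2l // ltW.
have b2 : `|m%:R * s - m%:R * h| <= del / 4 * m%:R.
  rewrite -mulrBr normrM ger0_norm // mulrC ler_wpM2r // ler_norml; apply/andP; split; lra.
have b3 : del / 4 * m%:R <= del * (1 + h) * m%:R / 4.
  have := mulr_ge0 (mulr_ge0 (ltW del0) h0) m0; move: (ltW del0); clear; lra.
set S1 := \sum_i _ in emp *; set S2 := \sum_l _ in emp gka.
have -> : S1 - m%:R * h = (S1 - S2) + (S2 - m%:R * s) + (m%:R * s - m%:R * h) by ring.
apply: le_trans (ler_normD _ _) _; apply: le_trans (lerD (ler_normD _ _) (lexx _)) _.
have : 0 <= del * (1 + h) * m%:R by rewrite mulr_ge0 // mulr_ge0 ?(ltW del0) // addr_ge0.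
move: emp gka b1 b2 b3; clear; lra.
Qed.

(** * Complex combinations and sparse coefficients *)

Lemma Re_lincomb (R : rcfType) (I : finType) (c z : I -> R[i]) :
  complex.Re (\sum_i c i * z i) =
  \sum_i (complex.Re (c i) * complex.Re (z i) - complex.Im (c i) * complex.Im (z i)).
Proof. by rewrite raddf_sum; apply: eq_bigr => i _; case: (c i) => ? ?; case: (z i). Qed.

Lemma Im_lincomb (R : rcfType) (I : finType) (c z : I -> R[i]) :
  complex.Im (\sum_i c i * z i) =
  \sum_i (complex.Re (c i) * complex.Im (z i) + complex.Im (c i) * complex.Re (z i)).
Proof. by rewrite raddf_sum; apply: eq_bigr => i _; case: (c i) => ? ?; case: (z i). Qed.

Lemma normc_sqr (R : rcfType) (z : R[i]) : normc z ^+ 2 = complex.Re z ^+ 2 + complex.Im z ^+ 2.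
Proof. by case: z => x y /=; rewrite sqr_sqrtr // addr_ge0 ?sqr_ge0. Qed.

Lemma normc_ge0 (R : rcfType) (z : R[i]) : 0 <= normc z.
Proof. by case: z => x y /=; rewrite sqrtr_ge0. Qed.

Lemma normc_sqrM (R : rcfType) (x y : R[i]) : normc (x * y) ^+ 2 = normc x ^+ 2 * normc y ^+ 2.
Proof. by rewrite !normc_sqr; case: x => ? ?; case: y => ? ? /=; ring. Qed.

Lemma Re_Im_le_normc (R : rcfType) (z : R[i]) :
  `|complex.Re z| <= normc z /\ `|complex.Im z| <= normc z.
Proof.
have n0 := normc_ge0 z; split; rewrite -[leLHS]ger0_norm // -(ger0_norm n0) -ler_sqr ?nnegrE //;
  rewrite ?normr_id ?real_normK ?num_real // normc_sqr ?lerDl ?lerDr ?sqr_ge0 //.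
Qed.

Lemma sparse_l1_le (R : realType) (I : finType) (T : {set I}) (t : nat) (a : R) (x : I -> R) :
  (#|T| <= t)%N -> (0 < t)%N -> 0 < a -> (forall i, i \notin T -> x i = 0) ->
  \sum_i x i ^+ 2 <= a^-1 -> \sum_i x i <= Num.sqrt (t%:R / a).
Proof.
move=> Tt t0 a0 xT xa; set r := Num.sqrt _.
have tR : 0 < t%:R :> R by rewrite ltr0n.
have ta0 : 0 < t%:R / a by rewrite divr_gt0.
have r0 : 0 < r by rewrite sqrtr_gt0.
have r2 : r ^+ 2 = t%:R / a by rewrite sqr_sqrtr // ltW.
(* AM-GM with the weight r / t on the support. *)
apply: le_trans (_ : _ <= \sum_i ((i \in T)%:R * (r / t%:R) + x i ^+ 2 * (t%:R / r)) / 2) _.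
  apply: ler_sum => i _; case: (boolP (i \in T)) => [_|/xT ->]; last first.
    by rewrite expr0n /= !mul0r addr0 mul0r.
  rewrite mul1r; have -> : (r / t%:R + x i ^+ 2 * (t%:R / r)) / 2 =
    x i + t%:R / (2 * r) * (x i - r / t%:R) ^+ 2 by field; rewrite !gt_eqF.
  by rewrite lerDl mulr_ge0 ?sqr_ge0 // divr_ge0 ?ler0n // mulr_ge0 // ltW.
rewrite -mulr_suml big_split /= -!mulr_suml.
have -> : \sum_i (i \in T)%:R = #|T|%:R :> R.
  rewrite -sum1_card natr_sum [RHS]big_mkcond /=.
  by apply: eq_bigr => i _; case: (i \in T).
have h1 : #|T|%:R * (r / t%:R) <= r.
  rewrite mulrCA ler_piMr ?(ltW r0) // ler_pdivrMr // mul1r ler_nat //.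
have h2 : (\sum_i x i ^+ 2) * (t%:R / r) <= r.
  apply: le_trans (_ : _ <= a^-1 * (t%:R / r)) _.
    by apply: ler_wpM2r xa; rewrite divr_ge0 ?ler0n // ltW.
  by rewrite mulrA ler_pdivrMr // mulrC -r2 expr2.
by rewrite ler_pdivrMr //; move: h1 h2; lra.
Qed.

Section RealParts.
Context {R : realType} {I : finType}.

Definition part (b : bool) (z : R[i]) : R := if b then complex.Im z else complex.Re z.

(** The real and imaginary parts of one complex combination are real combinations of the same
    functions, with two coefficient vectors of equal l1 norm, so one sampling event handles both. *)
Definition re_coef (c : I -> R[i]) (j : I * bool) : R :=
  if j.2 then - complex.Im (c j.1) else complex.Re (c j.1).

Definition im_coef (c : I -> R[i]) (j : I * bool) : R :=
  if j.2 then complex.Re (c j.1) else complex.Im (c j.1).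

Lemma re_coef_sum c (z : I -> R[i]) (s : R) :
  \sum_j re_coef c j * (s * part j.2 (z j.1)) = s * complex.Re (\sum_i c i * z i).
Proof.
rewrite sum_pair_bool Re_lincomb mulr_sumr; apply: eq_bigr => i _.
by rewrite /re_coef /part /=; ring.
Qed.

Lemma im_coef_sum c (z : I -> R[i]) (s : R) :
  \sum_j im_coef c j * (s * part j.2 (z j.1)) = s * complex.Im (\sum_i c i * z i).
Proof.
rewrite sum_pair_bool Im_lincomb mulr_sumr; apply: eq_bigr => i _.
by rewrite /im_coef /part /=; ring.
Qed.

Lemma norm_re_coef c : \sum_j `|re_coef c j| <= 2 * \sum_i normc (c i).
Proof.
rewrite sum_pair_bool mulr_sumr; apply: ler_sum => i _; rewrite /re_coef /= normrN.
by have [] := Re_Im_le_normc (c i); lra.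
Qed.

Lemma norm_im_coef c : \sum_j `|im_coef c j| <= 2 * \sum_i normc (c i).
Proof.
rewrite sum_pair_bool mulr_sumr; apply: ler_sum => i _; rewrite /im_coef /=.
by have [] := Re_Im_le_normc (c i); lra.
Qed.

End RealParts.

(** Accounting for the constant: the error delta / 6 and the squared bound 4 X cost 36 * 4 = 144;
    the two logarithms grow at most by factors 3 and 6, hence 3 * 36 = 108; and 144 * 108 < 2^14. *)
Lemma sampling_size (R : realType) (n : nat) (X delta eps m : R) :
  (0 < n)%N -> 1 <= X -> 0 < delta -> delta <= 1 -> 0 < eps -> eps <= 1 ->
  2 ^+ 74 * delta ^- 2 * X * (ln (expR 1 * n%:R) * ln (expR 1 * (X * delta^-1)) ^+ 2 + ln (2 / eps))
    <= m ->
  0 < m /\ 2 ^+ 60 * (delta / 6) ^- 2 * (4 * X) *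
    (ln (expR 1 * (n * 2 * 2)%:R) * ln (expR 1 * (4 * X / (delta / 6))) ^+ 2 + ln (2 / eps)) <= m.
Proof.
move=> n0 X1 d0 d1 e0 e1 hm.
have X0 : 0 < X by apply: lt_le_trans X1.
have Xd0 : 0 < X * delta^-1 by rewrite mulr_gt0 // invr_gt0.
move: hm; set a := ln (expR 1 * n%:R); set b := ln (expR 1 * (X * delta^-1)); set c := ln (2 / eps) => hm.
have nR : 0 < n%:R :> R by rewrite ltr0n.
have a1 : 1 <= a.
  by rewrite /a lnM ?posrE ?expR_gt0 // expRK lerDl ln_ge0 // ler1n.
have b1 : 1 <= b.
  rewrite /b lnM ?posrE ?expR_gt0 // expRK lerDl ln_ge0 // ler_pdivlMr // mul1r.
  exact: le_trans X1.
have c0 : 0 <= c by rewrite /c ln_ge0 // ler_pdivlMr // mul1r; move: e1; clear; lra.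
have aE : ln (expR 1 * (n * 2 * 2)%:R) <= 3 * a.
  have -> : expR 1 * (n * 2 * 2)%:R = 2 ^+ 2 * (expR 1 * n%:R) :> R by rewrite !natrM; ring.
  have -> : ln (2 ^+ 2 * (expR 1 * n%:R)) = ln (2 ^+ 2) + a :> R.
    by rewrite lnM // ?posrE ?exprn_gt0 // mulr_gt0 ?expR_gt0.
  by have := ln_pow2_le R 2; move: (ln _) a1 => z; clear; lra.
have bE : ln (expR 1 * (4 * X / (delta / 6))) <= 6 * b.
  apply: le_trans (_ : ln (2 ^+ 5 * (expR 1 * (X * delta^-1))) <= _).
    rewrite ler_ln ?posrE; last 2 first.
    - by rewrite mulr_gt0 ?expR_gt0 // divr_gt0 ?mulr_gt0 ?divr_gt0.
    - by rewrite mulr_gt0 ?exprn_gt0 // mulr_gt0 ?expR_gt0.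
    have -> : expR 1 * (4 * X / (delta / 6)) = 24 * (expR 1 * (X * delta^-1)).
      by field; rewrite gt_eqF.
    by apply: ler_wpM2r; [rewrite mulr_ge0 ?expR_ge0 // ltW | clear; lra].
  have -> : ln (2 ^+ 5 * (expR 1 * (X * delta^-1))) = ln (2 ^+ 5) + b.
    by rewrite lnM // ?posrE ?exprn_gt0 // mulr_gt0 ?expR_gt0.
  by have := ln_pow2_le R 5; move: (ln _) b1 => z; clear; lra.
have b0 : 0 <= ln (expR 1 * (4 * X / (delta / 6))).
  apply: ln_ge0; rewrite -[leLHS]mulr1; apply: ler_pM => //; first by have := expR1_ge2 R; clear; lra.
  rewrite ler_pdivlMr ?divr_gt0 // mul1r; move: X1 d1; clear; lra.
have b2E : ln (expR 1 * (4 * X / (delta / 6))) ^+ 2 <= 36 * b ^+ 2.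
  have -> : 36 * b ^+ 2 = (6 * b) ^+ 2 by ring.
  by rewrite lerXn2r ?nnegrE // (le_trans b0).
have a0 : 0 <= a by apply: le_trans a1.
have b20 := sqr_ge0 b.
split.
  apply: lt_le_trans hm; apply: mulr_gt0.
    by rewrite mulr_gt0 // mulr_gt0 ?invr_gt0 ?exprn_gt0.
  rewrite ltr_pwDl // mulr_gt0 ?(lt_le_trans _ a1) // exprn_gt0 // (lt_le_trans _ b1) //.
apply: le_trans hm.
apply: le_trans (_ : _ <= 2 ^+ 60 * (delta / 6) ^- 2 * (4 * X) * (3 * a * (36 * b ^+ 2) + c)) _.
  apply: ler_wpM2l.
    apply: mulr_ge0; last by rewrite mulr_ge0 // ltW.
    by apply: mulr_ge0; [exact: exprn_ge0 | rewrite invr_ge0 sqr_ge0].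
  rewrite lerD2r; apply: ler_pM => //; last exact: sqr_ge0.
  apply: ln_ge0; rewrite -[leLHS]mulr1; apply: ler_pM => //; first by have := expR1_ge2 R; clear; lra.
  by rewrite ler1n !muln_gt0 n0.
have dX0 : 0 <= delta ^- 2 * X by rewrite mulr_ge0 ?(ltW X0) // invr_ge0 sqr_ge0.
have -> : 2 ^+ 60 * (delta / 6) ^- 2 * (4 * X) * (3 * a * (36 * b ^+ 2) + c) =
   (delta ^- 2 * X) * (2 ^+ 60 * 144 * (108 * (a * b ^+ 2) + c)).
  by field; rewrite gt_eqF.
have -> : 2 ^+ 74 * delta ^- 2 * X * (a * b ^+ 2 + c) = (delta ^- 2 * X) * (2 ^+ 74 * (a * b ^+ 2 + c)) by ring.
apply: ler_wpM2l => //.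
by have := mulr_ge0 a0 b20; move: c0; clear; lra.
Qed.

(** * Densities and change of measure *)

Local Open Scope ereal_scope.

Lemma L2norm_sqr d (D : measurableType d) (R : realType) (rho : probability D R) (f : D -> R[i]) :
  L2norm rho f ^+ 2 = \int[rho]_x (normc (f x) ^+ 2)%:E.
Proof.
have -> : L2norm rho f ^+ 2 = L2norm rho f `^ 2%R.
  have := Lnorm_ge0 rho 2%:E (fun x => (normc (f x))%:E); rewrite -/(L2norm rho f).
  case: (L2norm rho f) => [r||] //.
    by rewrite lee_fin => r0; rewrite poweR_EFin powR_mulrn // EFin_expe.
  by move=> _; rewrite poweRyr // expe2 mulyy.
rewrite /L2norm poweR_Lnorm //; apply: eq_integral => x _.
by rewrite abse_EFin poweR_EFin powR_mulrn ?ger0_norm // normc_ge0.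
Qed.

Section ChangeOfMeasure.
Context d (D : measurableType d) (R : realType) (rho mu : probability D R).
Hypothesis dom : mu `<< rho.

Definition density (x : D) : R := fine (RNderiv rho mu x).

Lemma RNderivE x : RNderiv rho mu x = (density x)%:E.
Proof. by rewrite /density fineK //; exact: Radon_Nikodym_fin_num. Qed.

Lemma measurable_density : measurable_fun setT density.
Proof.
apply: (measurableT_comp (fine_measurable measurableT)).
by apply: measurable_int; exact: Radon_Nikodym_integrable.
Qed.

Lemma integral_density A : measurable A -> mu A = \int[rho]_(x in A) (density x)%:E.
Proof.
move=> mA; rewrite -[LHS]/(charge_of_finite_measure mu A).
rewrite (@Radon_Nikodym_integral _ _ _ _ rho) //.
by apply: eq_integral => x _; rewrite -RNderivE.
Qed.

(** The derivative is that of a signed measure, so its sign is known only almost everywhere: over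
    the set where it is negative it integrates to the [mu]-measure of that set, which is
    nonnegative, so its absolute value integrates to zero there. *)
Lemma density_ge0 : {ae rho, forall x, (0 <= density x)%R}.
Proof.
pose N := [set x | (density x < 0)%R].
have mdN : measurable_fun N (fun x => (density x)%:E).
  by apply/measurable_EFinP; apply: measurable_funTS; exact: measurable_density.
have mN : measurable N.
  rewrite [X in measurable X](_ : _ = density @^-1` `]-oo, 0%R[).
    by rewrite -[X in measurable X]setTI; exact: measurable_density.
  by apply/seteqP; split => x; rewrite /N /= in_itv.
have int0 : \int[rho]_(x in N) `|(density x)%:E| = 0.
  apply/eqP; rewrite eq_le integral_ge0 // andbT.
  rewrite (eq_integral (fun x => - (density x)%:E)); last first.
    by move=> x; rewrite inE => /ltW Nx; rewrite /= ler0_norm.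
  rewrite -[leLHS]oppeK -integral_ge0N; last first.
    by move=> x /ltW Nx; rewrite lee_fin oppr_ge0.
  under eq_integral do rewrite oppeK.
  by rewrite -integral_density // oppe_le0.
have := (ae_eq_integral_abs rho mN mdN).1 int0.
apply: filterS => x h; rewrite leNgt; apply/negP => Nx.
by have [/eqP] := h Nx; rewrite lt_eqF.
Qed.

Context (I : finType) (phi : I -> D -> R[i]) (Gam : R).
Hypothesis mRe : forall i, measurable_fun setT (fun x => complex.Re (phi i x)).
Hypothesis mIm : forall i, measurable_fun setT (fun x => complex.Im (phi i x)).
Hypothesis phiG : {ae rho, forall x, forall i,
  sqrte (weight rho mu x) * (normc (phi i x))%:E <= Gam%:E}.

(** A real power, hence finite and measurable everywhere. It stands for the square root of the
    weight where the density is positive; at a zero of the density the weight itself is +oo. *)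
Definition sqrt_weight (x : D) : R := (density x `^ (- 2^-1))%R.

Lemma sqrt_weight_sqr x : (0 < density x)%R -> (sqrt_weight x ^+ 2 = (density x)^-1)%R.
Proof.
move=> d0; rewrite /sqrt_weight powRN powR12_sqrt ?ltW // exprVn sqr_sqrtr // ltW //.
Qed.

Lemma measurable_sqrt_weight : measurable_fun setT sqrt_weight.
Proof. exact: (measurableT_comp (measurable_powR _)) measurable_density. Qed.

Lemma weightE x : (0 < density x)%R -> weight rho mu x = ((sqrt_weight x) ^+ 2)%:E.
Proof. by move=> d0; rewrite /weight RNderivE inver gt_eqF // sqrt_weight_sqr. Qed.

Lemma measurable_normc i : measurable_fun setT (fun x => normc (phi i x)).
Proof.
rewrite (_ : (fun x => _) = (fun x =>
  (complex.Re (phi i x) ^+ 2 + complex.Im (phi i x) ^+ 2) `^ 2^-1)%R); last first.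
  apply/funext => x; rewrite powR12_sqrt -normc_sqr ?sqr_ge0 //.
  by rewrite sqrtr_sqr ger0_norm // normc_ge0.
apply: (measurableT_comp (measurable_powR _)).
by apply: measurable_funD; apply: measurable_funX.
Qed.

Definition good_set : set D := [set x | (0 < density x)%R] `&`
  \bigcap_(i in [set: I]) [set x | (sqrt_weight x * normc (phi i x) <= Gam)%R].

Lemma measurable_good_set : measurable good_set.
Proof.
apply: measurableI.
  rewrite [X in measurable X](_ : _ = density @^-1` `]0%R, +oo[).
    by rewrite -[X in measurable X]setTI; exact: measurable_density.
  by apply/seteqP; split => x; rewrite /= in_itv /= andbT.
apply: fin_bigcap_measurable; first exact: finite_finset.
move=> i _; rewrite [X in measurable X](_ : _ =
  (fun x => (sqrt_weight x * normc (phi i x))%R) @^-1` `]-oo, Gam]).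
  rewrite -[X in measurable X]setTI.
  apply: (_ : measurable_fun setT (fun x => (sqrt_weight x * normc (phi i x))%R)) => //.
  by apply: measurable_funM; [exact: measurable_sqrt_weight | exact: measurable_normc].
by apply/seteqP; split => x; rewrite /= in_itv.
Qed.

(** Where the density vanishes the weight is +oo, and a finite bound on sqrt w |phi_i| forces phi_i
    = 0. So [rho] sees nothing of the dictionary where [mu] has no density, and its L2 norms can be
    computed under [mu]. *)
Lemma ae_good_set : {ae rho, forall x, good_set x \/
  density x = 0%R /\ forall i, phi i x = 0%R}.
Proof.
have := density_ge0; have := phiG; apply: filterS2 => x hG d0.
have [dx0|dx0] := eqVneq (density x) 0%R.
  right; split => // i; apply: ComplexField.Normc.eq0_normc.
  have := hG i; rewrite /weight RNderivE dx0 inve0 /=.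
  have := normc_ge0 (phi i x); rewrite le_eqVlt => /orP[/eqP <- //|n0].
  by rewrite gt0_mulye ?lte_fin.
left; have {}dx0 : (0 < density x)%R by rewrite lt_neqAle eq_sym dx0.
split=> // i _ /=; have := hG i; rewrite weightE // /= lee_fin sqrtr_sqr.
by rewrite ger0_norm // powR_ge0.
Qed.

Lemma mu_good_set : mu good_set = 1.
Proof.
have mG := measurable_good_set.
have : mu (~` good_set) = 0.
  rewrite integral_density; last exact: measurableC.
  rewrite (ae_eq_integral (cst 0)); first exact: integral0.
  - exact: measurableC.
  - by apply/measurable_EFinP; apply: measurable_funTS; exact: measurable_density.
  - exact: measurable_cst.
  - by apply: filterS ae_good_set => x [|[-> _]].
rewrite probability_setC // => h.
have : mu good_set \is a fin_num by exact: fin_num_measure.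
by move: h; case: (mu good_set) => // r /eqP; rewrite -EFinB eqe subr_eq0 => /eqP <-.
Qed.

(** Off [good_set] the integrand vanishes almost everywhere; on it the density cancels its inverse.
    The bound [c] supplies the integrability under [mu] that the change of variables asks for. *)
Lemma integral_change (N : D -> R) (c : R) : measurable_fun setT N -> (forall x, 0 <= N x)%R ->
  (forall x, (forall i, phi i x = 0%R) -> N x = 0%R) ->
  (forall x, good_set x -> (sqrt_weight x ^+ 2 * N x <= c)%R) ->
  \int[rho]_x (N x)%:E = \int[mu]_(x in good_set) (sqrt_weight x ^+ 2 * N x)%:E.
Proof.
move=> mN N0 Nphi Nc; have mG := measurable_good_set.
have mNE : measurable_fun setT (fun x => (N x)%:E) by apply/measurable_EFinP.
have mh : measurable_fun setT (fun x => (sqrt_weight x ^+ 2 * N x)%R).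
  by apply: measurable_funM => //; apply: measurable_funX; exact: measurable_sqrt_weight.
have -> : \int[rho]_x (N x)%:E = \int[rho]_(x in good_set) (N x)%:E.
  rewrite -[X in integral _ X](setUv good_set) ge0_integral_setU //; last 4 first.
  - exact: measurableC.
  - by rewrite setUv.
  - by move=> x _; rewrite lee_fin.
  - by apply/disj_setPCl.
  rewrite [X in _ + X](_ : _ = 0) ?adde0 //.
  rewrite (ae_eq_integral (cst 0)); first exact: integral0.
  - exact: measurableC.
  - exact: measurable_funTS.
  - exact: measurable_cst.
  - by apply: filterS ae_good_set => x [//|[_ /Nphi ->]].
have hint : mu.-integrable good_set (fun x => (sqrt_weight x ^+ 2 * N x)%:E).
  apply: (measurable_bounded_integrable (f := fun x => (sqrt_weight x ^+ 2 * N x)%R)) => //.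
  - by rewrite ltey_eq fin_num_measure.
  - exact: measurable_funTS.
  - exists c; split; first exact: num_real.
    move=> r cr x Gx /=; apply: le_trans (ltW cr); rewrite ger0_norm ?Nc //.
    by rewrite mulr_ge0 ?sqr_ge0.
rewrite -(Radon_Nikodym_change_of_variables dom mG hint).
apply: eq_integral => x; rewrite inE => -[d0 _].
rewrite -[Radon_Nikodym _ _ x]/(RNderiv rho mu x) RNderivE -EFinM.
by rewrite sqrt_weight_sqr //; congr EFin; field; rewrite gt_eqF.
Qed.

End ChangeOfMeasure.

Section WeightedDictionary.
Context d (D : measurableType d) (R : realType) (rho mu : probability D R).
Context (I : finType) (phi : I -> D -> R[i]) (Gam : R).
Hypothesis dom : mu `<< rho.
Hypothesis mRe : forall i, measurable_fun setT (fun x => complex.Re (phi i x)).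
Hypothesis mIm : forall i, measurable_fun setT (fun x => complex.Im (phi i x)).
Hypothesis phiG : {ae rho, forall x, forall i,
  sqrte (weight rho mu x) * (normc (phi i x))%:E <= Gam%:E}.

Let sw := sqrt_weight rho mu.
Let D0 := good_set rho mu phi Gam.

Definition weighted_part (j : I * bool) (x : D) : R := (sw x * part j.2 (phi j.1 x))%R.

Lemma measurable_weighted_part j : measurable_fun setT (weighted_part j).
Proof.
apply: measurable_funM; first exact: measurable_sqrt_weight.
by case: j => i [] /=.
Qed.

Lemma norm_weighted_part j x : D0 x -> (`|weighted_part j x| <= Gam)%R.
Proof.
move=> [_ /(_ j.1 Logic.I) /=]; apply: le_trans.
rewrite /weighted_part normrM ger0_norm ?powR_ge0 // ler_wpM2l ?powR_ge0 //.
by have [] := Re_Im_le_normc (phi j.1 x); case: (j.2).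
Qed.

Lemma lincomb_parts (c : I -> R[i]) x :
  ((\sum_j re_coef c j * weighted_part j x) ^+ 2 + (\sum_j im_coef c j * weighted_part j x) ^+ 2 =
   sw x ^+ 2 * normc (lincomb phi c x) ^+ 2)%R.
Proof.
rewrite /weighted_part (re_coef_sum c (fun i => phi i x)) (im_coef_sum c (fun i => phi i x)).
by rewrite normc_sqr -/(lincomb phi c x) !exprMn mulrDr.
Qed.

Lemma measurable_lincomb_sqr (c : I -> R[i]) :
  measurable_fun setT (fun x => (normc (lincomb phi c x) ^+ 2)%R).
Proof.
rewrite (_ : (fun x => _) = (fun x => complex.Re (lincomb phi c x) ^+ 2 +
  complex.Im (lincomb phi c x) ^+ 2)%R); last by apply/funext => x; rewrite normc_sqr.
apply: measurable_funD; apply: measurable_funX.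
  rewrite (_ : (fun x => _) = (fun x => \sum_i (complex.Re (c i) * complex.Re (phi i x) -
    complex.Im (c i) * complex.Im (phi i x))))%R; last by apply/funext => x; rewrite Re_lincomb.
  by apply: measurable_sum => i; apply: measurable_funB; apply: measurable_funM.
rewrite (_ : (fun x => _) = (fun x => \sum_i (complex.Re (c i) * complex.Im (phi i x) +
  complex.Im (c i) * complex.Re (phi i x))))%R; last by apply/funext => x; rewrite Im_lincomb.
by apply: measurable_sum => i; apply: measurable_funD; apply: measurable_funM.
Qed.

Lemma L2norm_lincomb (c : I -> R[i]) : L2norm rho (lincomb phi c) ^+ 2 =
  \int[mu]_(x in D0) (sw x ^+ 2 * normc (lincomb phi c x) ^+ 2)%:E.
Proof.
have comb_le (z : I * bool -> R) x : D0 x ->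
    (`|\sum_j z j * weighted_part j x| <= (\sum_j `|z j|) * Gam)%R.
  move=> Dx; apply: le_trans (ler_norm_sum _ _ _) _; rewrite mulr_suml.
  by apply: ler_sum => j _; rewrite normrM ler_wpM2l //; exact: norm_weighted_part.
rewrite L2norm_sqr (integral_change dom mRe mIm phiG
  (c := (((\sum_j `|re_coef c j|) * Gam) ^+ 2 + ((\sum_j `|im_coef c j|) * Gam) ^+ 2)%R)) //.
- exact: measurable_lincomb_sqr.
- by move=> x; exact: sqr_ge0.
- move=> x h; rewrite /lincomb big1 ?ComplexField.Normc.normc0 ?expr0n // => i _.
  by rewrite h mulr0.
move=> x Dx; rewrite -lincomb_parts; apply: lerD.
  rewrite -[leLHS]real_normK ?num_real //.
  by rewrite lerXn2r ?nnegrE ?comb_le // (le_trans _ (comb_le _ _ Dx)).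
rewrite -[leLHS]real_normK ?num_real //.
by rewrite lerXn2r ?nnegrE ?comb_le // (le_trans _ (comb_le _ _ Dx)).
Qed.

End WeightedDictionary.

(** * The size of Gamma and the norm equivalence *)

(** Tested on a coordinate vector, the lower bound gives a <= ||phi_i0||^2, which is the
    [mu]-integral of w |phi_i0|^2. It ensures Gamma^2 t / a >= 1, so that the logarithms in the
    sample size are at least 1. *)
Lemma Gamma_sqr_ge d (D : measurableType d) (R : realType) (rho mu : probability D R)
    (I : finType) (phi : I -> D -> R[i]) (Gam a : R) (i0 : I) :
  mu `<< rho ->
  (forall i, measurable_fun setT (fun x => complex.Re (phi i x))) ->
  (forall i, measurable_fun setT (fun x => complex.Im (phi i x))) ->
  {ae rho, forall x, forall i, sqrte (weight rho mu x) * (normc (phi i x))%:E <= Gam%:E} ->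
  (forall c : I -> R[i],
     (a * \sum_(i : I) normc (c i) ^+ 2)%:E <= L2norm rho (lincomb phi c) ^+ 2) ->
  (a <= Gam ^+ 2)%R.
Proof.
move=> dom mRe mIm phiG lb.
pose c i : R[i] := (i == i0)%:R%R.
have cE x : lincomb phi c x = phi i0 x.
  rewrite /lincomb (bigD1 i0) //= /c eqxx mul1r big1 ?addr0 // => i /negPf ->.
  by rewrite mul0r.
have := lb c.
have -> : (\sum_i normc (c i) ^+ 2 = 1)%R.
  rewrite (bigD1 i0) //= /c eqxx big1 => [|i /negPf ->].
    by rewrite addr0 (_ : 1%:R = 1)%R // ComplexField.Normc.normc1 expr1n.
  by rewrite ComplexField.Normc.normc0 expr0n.
rewrite mulr1 (L2norm_lincomb dom mRe mIm phiG) => h.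
rewrite -lee_fin; apply: (le_trans h).
have mG := @measurable_good_set _ _ _ _ _ dom _ _ Gam mRe mIm.
have <- : \int[mu]_(x in good_set rho mu phi Gam) (cst (Gam ^+ 2)%:E) x = (Gam ^+ 2)%:E.
  by rewrite integral_cst // [X in _ * X](_ : _ = 1) ?mule1 //; exact: mu_good_set.
apply: ge0_le_integral => //=.
- by move=> x _; rewrite lee_fin mulr_ge0 ?sqr_ge0.
- apply/measurable_EFinP; apply: measurable_funTS; apply: measurable_funM.
    by apply: measurable_funX; exact: measurable_sqrt_weight.
  exact: measurable_lincomb_sqr.
move=> x [_ /(_ i0 Logic.I) /= Gx]; rewrite cE lee_fin -exprMn.
have s0 : (0 <= sqrt_weight rho mu x * normc (phi i0 x))%R.
  by rewrite mulr_ge0 ?powR_ge0 // normc_ge0.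
by rewrite lerXn2r ?nnegrE // (le_trans s0).
Qed.

Lemma Gamma_of_ae d (D : measurableType d) (R : realType) (rho : probability D R)
    (I : finType) (phi : I -> D -> R[i]) (w : D -> \bar R) (Gam : R) :
  Gamma_of rho phi w = Gam%:E ->
  {ae rho, forall x, forall i, sqrte (w x) * (normc (phi i x))%:E <= Gam%:E}.
Proof.
(* The norm of exponent +oo is defined as the essential supremum only on a space of positive mass,
   hence the side condition. *)
rewrite /Gamma_of unlock /Lnorm ifT => [GE|]; last first.
  by rewrite [X in 0 < X](_ : _ = 1) ?lte01 //; exact: probability_setT.
have := ess_sup_ge rho (abse \o (fun y =>
   \big[maxe/0]_(i : I) (sqrte (w y) * (normc (phi i y))%:E))).
apply: filterS => x; rewrite GE /= => h i; apply: le_trans h.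
apply: le_trans (lee_abs _).
exact: (le_bigmax _ (fun i => sqrte (w x) * (normc (phi i x))%:E)).
Qed.

(** An infinite Gamma would require an infinite sample, so the size condition forces Gamma to be
    real. Positivity of [G] remains a premise, under which the extended logarithm is the real
    one. *)
Lemma sample_size_real (R : realType) (Gam : \bar R) (C a delta eps : R) (n t m : nat) :
  0 <= Gam -> (0 < C)%R -> (0 < a)%R -> (1 <= t)%N -> (1 <= n)%N -> (0 < delta)%R ->
  let Gamma2a := Gam ^+ 2 * (a^-1)%:E in
  (C * delta ^- 2)%:E * Gamma2a * t%:R%:E *
    ((ln (expR 1 * n%:R))%:E * lne ((expR 1)%:E * (Gamma2a * t%:R%:E * (delta^-1)%:E)) ^+ 2
     + (ln (2 / eps))%:E) <= m%:R%:E ->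
  exists2 G : R, Gam = G%:E &
  (0 < G)%R ->
  (C * delta ^- 2 * (G ^+ 2 / a * t%:R) *
    (ln (expR 1 * n%:R) * ln (expR 1 * (G ^+ 2 / a * t%:R * delta^-1)) ^+ 2 + ln (2 / eps)) <= m%:R)%R.
Proof.
move=> G0 C0 a0 t1 n1 d0; cbv zeta.
have ai0 : (0 < a^-1)%R by rewrite invr_gt0.
have di0 : (0 < delta^-1)%R by rewrite invr_gt0.
have tR : (0 < t%:R :> R)%R by rewrite ltr0n.
have nR : (1 <= n%:R :> R)%R by rewrite ler1n.
have ln0 : (0 < ln (expR 1 * n%:R) :> R)%R.
  rewrite lnM ?posrE ?expR_gt0 ?(lt_le_trans (@ltr01 R) nR) // expRK.
  by rewrite ltr_pwDl // ln_ge0.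
have Cd : (0 < C * delta ^- 2)%R by rewrite mulr_gt0 // invr_gt0 exprn_gt0.
case: Gam G0 => [G|_|] //; last first.
  rewrite expe2 mulyy (gt0_mulye (x := a^-1%:E)) ?lte_fin // gt0_muley ?lte_fin //.
  rewrite (gt0_mulye (x := t%:R%:E)) ?lte_fin // (gt0_mulye (x := delta^-1%:E)) ?lte_fin //.
  rewrite (gt0_muley (x := (expR 1)%:E)) ?lte_fin ?expR_gt0 // [lne _]/= expe2 mulyy.
  by rewrite gt0_muley ?lte_fin // addye // mulyy leye_eq.
rewrite lee_fin => G0 h; exists G => // Gp; move: h.
rewrite -EFin_expe -!EFinM lne_EFin; last first.
  by rewrite mulr_gt0 ?expR_gt0 // mulr_gt0 // mulr_gt0 // mulr_gt0 // exprn_gt0.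
by rewrite -EFin_expe -EFinM lee_fin !mulrA.
Qed.

Theorem theorem5 (R : realType) :
  exists dstar C : R,
  [/\ (0 < dstar)%R, (dstar < 1)%R, (0 < C)%R &
  forall (d : measure_display) (D : topMeasurableType d)
    (rho : probability D R)
    (I : finType) (n : nat) (phi : I -> D -> R[i]) (a b : R)
    (mu : probability D R) (t : nat) (delta eps : R) (m : nat)
    (d' : measure_display) (Omega : measurableType d')
    (P : probability Omega R) (y : 'I_m -> {RV P >-> D}),
  #|I| = n ->
  (forall i, L2fun rho (phi i)) ->
  lin_indep rho phi ->
  (0 < a)%R -> (a <= b)%R ->
  (forall c : I -> R[i],
     (a * \sum_(i : I) normc (c i) ^+ 2)%:E <= L2norm rho (lincomb phi c) ^+ 2
     /\ L2norm rho (lincomb phi c) ^+ 2 <= (b * \sum_(i : I) normc (c i) ^+ 2)%:E) ->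
  mu `<< rho ->
  {ae rho, forall x, msupport mu x -> 0 < RNderiv rho mu x} ->
  (1 <= t)%N -> (t <= n)%N ->
  (0 < delta)%R -> (delta < dstar)%R ->
  (0 < eps)%R -> (eps < 1)%R ->
  (forall (i : 'I_m) (A : set D), measurable A -> distribution P (y i) A = mu A) ->
  mutually_independent P y ->
  let w := weight rho mu in
  let Gamma2a := Gamma_of rho phi w ^+ 2 * (a^-1)%:E in
  (C * delta ^- 2)%:E * Gamma2a * t%:R%:E *
    ((ln (expR 1 * n%:R))%:E * lne ((expR 1)%:E * (Gamma2a * t%:R%:E * (delta^-1)%:E)) ^+ 2
     + (ln (2 / eps))%:E) <= m%:R%:E ->
  exists E : set Omega,
  [/\ measurable E, (1 - eps)%:E <= P E &
    forall omega, E omega ->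
    exists alpha beta : R,
    [/\ (1 - delta <= alpha)%R, (alpha <= beta)%R, (beta <= 1 + delta)%R &
      forall (T : {set I}) (p : D -> R[i]), (#|T| <= t)%N -> polspan phi T p ->
      let S := (m%:R^-1)%:E *
        \sum_(i < m) w (y i omega) * (normc (p (y i omega)) ^+ 2)%:E in
      alpha%:E * L2norm rho p ^+ 2 <= S /\ S <= beta%:E * L2norm rho p ^+ 2]]].
Proof.
have C0 : (0 < 2 ^+ 74 :> R)%R by exact: exprn_gt0.
exists (1/2)%R, (2 ^+ 74)%R; split; [lra | lra | exact: C0 |].
move=> d D rho I n phi a b mu t delta eps m d' Omega P y nE phiL2 _ a0 ab riesz dom _ t1 tn
  delta0 deltah eps0 eps1 law indep w Gamma2a sz.
have delta1 : (delta <= 1)%R by move: deltah; clear; lra.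
have n1 : (0 < n)%N by apply: leq_trans tn.
have mRe i : measurable_fun setT (fun x => complex.Re (phi i x)) by case: (phiL2 i).
have mIm i : measurable_fun setT (fun x => complex.Im (phi i x)) by case: (phiL2 i).
have [G GE sz'] := sample_size_real (Lnorm_ge0 _ _ _) C0 a0 t1 n1 delta0 sz.
have phiG := Gamma_of_ae GE.
have [i0 _] : exists i : I, true.
  by move: n1; rewrite -nE => /card_gt0P[i _]; exists i.
have aG := Gamma_sqr_ge i0 dom mRe mIm phiG (fun c => (riesz c).1).
have G0 : (0 < G)%R.
  have : 0 <= G%:E by rewrite -GE Lnorm_ge0.
  rewrite lee_fin le_eqVlt => /orP[/eqP G0|//]; exfalso; move: aG.
  by rewrite -G0 expr0n /= leNgt a0.
have {sz'} sz' := sz' G0.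
set X := (G ^+ 2 / a * t%:R)%R in sz'.
have tR : (1 <= t%:R :> R)%R by rewrite ler1n.
have X1 : (1 <= X)%R.
  by rewrite -[leLHS]mulr1; apply: ler_pM => //; rewrite ler_pdivlMr // mul1r.
pose r : R := Num.sqrt (t%:R / a).
have ta0 : (0 < t%:R / a :> R)%R by rewrite divr_gt0 // (lt_le_trans _ tR).
have r0 : (0 < r)%R by rewrite sqrtr_gt0.
have r2 : (r ^+ 2 = t%:R / a)%R by rewrite sqr_sqrtr // ltW.
(* [r] bounds the sum of the moduli of a t-sparse coefficient vector of a function of norm 1;
   splitting into real and imaginary parts at most doubles it. *)
pose B : R := (2 * r)%R.
have B0 : (0 < B)%R by rewrite mulr_gt0.
have BGE : ((B * G) ^+ 2 = 4 * X)%R by rewrite !exprMn r2 /X; ring.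
have BG0 : (0 < B * G)%R by rewrite mulr_gt0.
have BG1 : (1 <= B * G)%R.
  rewrite -(ler_pXn2r (n := 2)) ?nnegrE // ?ltW // BGE expr1n.
  by move: X1; clear; lra.
have [mR sz6] := sampling_size n1 X1 delta0 delta1 eps0 (ltW eps1) sz'.
pose D0 := good_set rho mu phi G.
pose g := weighted_part rho mu phi.
have KE : #|{: I * bool}| = (n * 2)%N by rewrite card_prod card_bool nE.
have d60 : (0 < delta / 6)%R by rewrite divr_gt0.
have d61 : (delta / 6 <= 1)%R by move: delta1; clear; lra.
have [E [mE PE EP]] : exists E : set Omega, [/\ measurable E, (1 - eps)%:E <= P E &
    forall w, E w -> (forall i, D0 (y i w)) /\
      forall c : I * bool -> R, (\sum_j `|c j| <= B)%R ->
      exists2 h, \int[mu]_(x in D0) ((\sum_j c j * g j x) ^+ 2)%:E = h%:E &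
        (`|\sum_i (\sum_j c j * g j (y i w)) ^+ 2 - m%:R * h| <=
         2 * (delta / 6) * (1 + h) * m%:R)%R].
  apply: (@sampling_bounded _ D R mu (I * bool)%type g D0 G B (delta / 6) eps m
    _ Omega P y) => //.
  - exact: measurable_good_set.
  - exact: mu_good_set.
  - by move=> j; exact: measurable_weighted_part.
  - by move=> j x; exact: norm_weighted_part.
  - by rewrite KE muln_gt0 n1.
  - exact: ltW.
  - by rewrite KE BGE.
exists E; split => // omega Eo; have [yD0 {}EP] := EP omega Eo.
exists (1 - delta)%R, (1 + delta)%R; split => //; first by move: delta0; clear; lra.
move=> T p Tt [c0 pE]; cbv zeta.
(* Extension by zero outside [T] makes p a combination over all of [I], to which the two-sided bound
   [riesz] applies. *)
pose c i : R[i] := if i \in T then c0 i else 0%R.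
have {pE} pE : p = lincomb phi c.
  apply/funext => x; rewrite pE /lincomb big_mkcond; apply: eq_bigr => i _.
  by rewrite /c; case: (i \in T); rewrite ?mul0r.
have [low up] := riesz c; rewrite -pE in low up.
have N0 : 0 <= L2norm rho p ^+ 2 by exact: sqre_ge0.
have NI := L2norm_lincomb dom mRe mIm phiG c; rewrite -pE in NI.
have [N NE] : exists N : R, L2norm rho p ^+ 2 = N%:E.
  move: up N0; case: (L2norm rho p ^+ 2) => [N||] //; by exists N.
rewrite NE in low up N0 NI *.
move: low N0; rewrite !lee_fin => low N0.
have c2 : (\sum_i normc (c i) ^+ 2 <= N / a)%R by rewrite ler_pdivlMr // mulrC.
pose sw := sqrt_weight rho mu.
have SE : \sum_(i < m) w (y i omega) * (normc (p (y i omega)) ^+ 2)%:E =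
    (\sum_(i < m) sw (y i omega) ^+ 2 * normc (p (y i omega)) ^+ 2)%:E.
  rewrite -sumEFin; apply: eq_bigr => i _; have [dy _] := yD0 i.
  by rewrite /w weightE.
rewrite SE -!EFinM !lee_fin.
(* At norm zero the lower bound annihilates every coefficient; otherwise p can be scaled to norm 1,
   where the l1 bound holds. *)
have [N00|N00] := eqVneq N 0%R.
  have c00 i : c i = 0%R.
    apply: ComplexField.Normc.eq0_normc; apply/eqP; rewrite -sqrf_eq0.
    have : (\sum_i normc (c i) ^+ 2 == 0)%R.
      rewrite eq_le sumr_ge0 ?andbT; last by move=> j _; exact: sqr_ge0.
      by apply: le_trans c2 _; rewrite N00 mul0r.
    by rewrite psumr_eq0 => [/allP/(_ i (mem_index_enum _))|j _]; last exact: sqr_ge0.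
  rewrite big1 => [|i _]; first by rewrite N00 !mulr0.
  rewrite pE /lincomb big1 ?ComplexField.Normc.normc0 ?expr0n ?mulr0 // => j _.
  by rewrite c00 mul0r.
have {N00} Np : (0 < N)%R by rewrite lt_neqAle eq_sym N00.
pose s := Num.sqrt N.
have s0 : (0 < s)%R by rewrite sqrtr_gt0.
have s2 : (s ^+ 2 = N)%R by rewrite sqr_sqrtr.
have si2 : (normc (s^-1)%:C%C ^+ 2 = N^-1 :> R)%R.
  by rewrite normc_sqr /= expr0n addr0 exprVn s2.
pose cs i : R[i] := ((s^-1)%:C%C * c i)%R.
have csN x : (normc (lincomb phi cs x) ^+ 2 = N^-1 * normc (p x) ^+ 2)%R.
  rewrite pE -si2 -normc_sqrM /lincomb mulr_sumr; congr (normc _ ^+ 2)%R.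
  by apply: eq_bigr => i _; rewrite mulrA.
have l1 : (\sum_i normc (cs i) <= r)%R.
  apply: (sparse_l1_le Tt t1 a0) => [i /negPf iT|].
    by rewrite /cs /c iT mulr0 ComplexField.Normc.normc0.
  under eq_bigr do rewrite /cs normc_sqrM si2.
  by rewrite -mulr_sumr mulrC ler_pdivrMr // mulrC.
have B1 : (\sum_j `|re_coef cs j| <= B)%R.
  by apply: le_trans (norm_re_coef cs) _; rewrite ler_pM2l.
have B2 : (\sum_j `|im_coef cs j| <= B)%R.
  by apply: le_trans (norm_im_coef cs) _; rewrite ler_pM2l.
have [h1 h1E b1] := EP _ B1; have [h2 h2E b2] := EP _ B2.
have parts x : ((\sum_j re_coef cs j * g j x) ^+ 2 + (\sum_j im_coef cs j * g j x) ^+ 2 =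
    N^-1 * (sw x ^+ 2 * normc (p x) ^+ 2))%R.
  by rewrite /g lincomb_parts csN mulrCA.
have mcomb (z : I * bool -> R) : measurable_fun D0 (fun x => ((\sum_j z j * g j x) ^+ 2)%:E).
  apply/measurable_EFinP; apply: measurable_funTS; apply: measurable_funX.
  by apply: measurable_sum => j; apply: measurable_funM => //; exact: measurable_weighted_part.
have mD0 : measurable D0 by exact: measurable_good_set.
(* For a function of norm 1 the second moments of the two parts add up to 1, so the errors 2 (delta
   / 6) (1 + h1) and 2 (delta / 6) (1 + h2) sum to exactly delta: the origin of the 6. *)
have h12 : (h1 + h2 = 1)%R.
  apply: EFin_inj; rewrite EFinD -h1E -h2E -ge0_integralD //; last 2 first.
  - by move=> x _; rewrite lee_fin sqr_ge0.
  - by move=> x _; rewrite lee_fin sqr_ge0.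
  under eq_integral do rewrite -EFinD parts EFinM.
  rewrite ge0_integralZl_EFin ?invr_ge0 //.
  - by rewrite -NI -EFinM mulVf // gt_eqF.
  - by move=> x _; rewrite lee_fin mulr_ge0 ?sqr_ge0.
  - apply/measurable_EFinP; apply: measurable_funTS; apply: measurable_funM.
      by apply: measurable_funX; exact: measurable_sqrt_weight.
    by rewrite pE; exact: measurable_lincomb_sqr.
set SN := (\sum_(i < m) _)%R.
have SNE : (\sum_(i < m) (\sum_j re_coef cs j * g j (y i omega)) ^+ 2 +
   \sum_(i < m) (\sum_j im_coef cs j * g j (y i omega)) ^+ 2 = N^-1 * SN)%R.
  rewrite -big_split /= mulr_sumr; apply: eq_bigr => i _; exact: parts.
have dev : (`|N^-1 * SN - m%:R| <= delta * m%:R)%R.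
  move: b1 b2 SNE.
  move: (\sum_(i < m) (\sum_j re_coef cs j * g j (y i omega)) ^+ 2)%R => S1.
  move: (\sum_(i < m) (\sum_j im_coef cs j * g j (y i omega)) ^+ 2)%R => S2 b1 b2 SNE.
  have -> : (N^-1 * SN - m%:R = (S1 - m%:R * h1) + (S2 - m%:R * h2))%R.
    have m12 : (m%:R = m%:R * (h1 + h2) :> R)%R by rewrite h12 mulr1.
    by rewrite -SNE [X in (_ - X = _)%R]m12; ring.
  apply: le_trans (ler_normD _ _) _; apply: le_trans (lerD b1 b2) _.
  rewrite -!mulrDl -mulrDr (_ : 1 + h1 + (1 + h2) = 2 + (h1 + h2))%R; last by ring.
  by rewrite h12 le_eqVlt; apply/orP; left; apply/eqP; field.
have SNN : (m%:R^-1 * SN = N * (m%:R^-1 * (N^-1 * SN)))%R by field; rewrite !gt_eqF.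
rewrite SNN; move: dev; rewrite ler_norml; set Y := (N^-1 * SN)%R => /andP[lo hi].
rewrite mulrC [X in _ /\ (_ <= X)%R]mulrC; split; rewrite ler_pM2l //.
  by rewrite ler_pdivlMl //; move: lo; clear; lra.
by rewrite ler_pdivrMl //; move: hi; clear; lra.
Qed.
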